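(* Let $\theta$ be a subtle cardinal. Then there exists $\kappa<\theta$ such that $\mathcal{R}(\theta)\models$ ''$\kappa$ is unfoldable''.
   Context: $\mathcal{R}(\kappa)=V_\kappa$ is the set of all sets of rank less than $\kappa$. For structures $\mathfrak{A}=(M,E,\dots)$ and $\mathfrak{B}=(N,F,\dots)$ in the same language, $\mathfrak{B}$ is an end elementary extension (eee) of $\mathfrak{A}$, written $\mathfrak{A}\prec_e\mathfrak{B}$, if $\mathfrak{B}$ is a proper elementary extension of $\mathfrak{A}$ and for every $a\in M$, $\{b\in M : bEa\}=\{b\in N: bFa\}$. $o(M)$ denotes the ordinal height of $M$. A cardinal $\kappa$ is unfoldable if it is inaccessible and for every ordinal $\alpha$ and every $S\subset\mathcal{R}(\kappa)$ there is a well-founded eee $M$ of $(\mathcal{R}(\kappa),\in,S)$ with $o(M)\geq\alpha$. An inaccessible cardinal $\theta$ is subtle if for any sequence $(S_\alpha)_{\alpha<\theta}$ with each $S_\alpha\subset\alpha$ and any club $C\subset\theta$, there are $\beta<\gamma$, both in $C$, such that $S_\gamma\cap\beta=S_\beta$. *)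

(* Defs.v *)
(** The universe of sets: Aczel's well-founded trees, quotiented by bisimilarity
    so that equality of sets is Leibniz equality; a set is a class of trees. *)

Inductive tree : Type := node (A : Type) (f : A -> tree).

Fixpoint eqt (x y : tree) : Prop :=
  match x, y with
  | node A f, node B g =>
      (forall i, exists j, eqt (f i) (g j)) /\
      (forall j, exists i, eqt (f i) (g j))
  end.

Definition V : Type := {c : tree -> Prop | exists x, c = eqt x}.

Definition class (x : tree) : V :=
  exist _ (eqt x) (ex_intro _ x eq_refl).

Definition mem (a b : V) : Prop :=
  exists (A : Type) (f : A -> tree) (i : A),
    a = class (f i) /\ b = class (node A f).

(** First-order formulas of set theory, in higher-order abstract syntax:
    [T] is the type of variables, instantiated by the carrier of the structure
    when a formula is evaluated.  All the
    formulas below are polymorphic in [T], so that they are genuine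
    first-order formulas in the language with only the membership symbol, and
    in [sat E phi] every quantifier ranges over the carrier [U]. *)

Inductive form (T : Type) : Type :=
  | Mem (x y : T)
  | Eq (x y : T)
  | Not (p : form T)
  | And (p q : form T)
  | Or (p q : form T)
  | Imp (p q : form T)
  | Iff (p q : form T)
  | All (p : T -> form T)
  | Ex (p : T -> form T).

Arguments Mem {T} x y.
Arguments Eq {T} x y.
Arguments Not {T} p.
Arguments And {T} p q.
Arguments Or {T} p q.
Arguments Imp {T} p q.
Arguments Iff {T} p q.
Arguments All {T} p.
Arguments Ex {T} p.

Fixpoint sat {U : Type} (E : U -> U -> Prop) (phi : form U) : Prop :=
  match phi with
  | Mem x y => E x y
  | Eq x y => x = y
  | Not p => ~ sat E p
  | And p q => sat E p /\ sat E q
  | Or p q => sat E p \/ sat E q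
  | Imp p q => sat E p -> sat E q
  | Iff p q => sat E p <-> sat E q
  | All p => forall x, sat E (p x)
  | Ex p => exists x, sat E (p x)
  end.

Declare Scope form_scope.
Delimit Scope form_scope with form.
Bind Scope form_scope with form.

Notation "x ∈ y" := (Mem x y) (at level 70, no associativity) : form_scope.
Notation "x ≐ y" := (Eq x y) (at level 70, no associativity) : form_scope.
Notation "¬ p" := (Not p) (at level 75, right associativity) : form_scope.
Notation "p ∧ q" := (And p q) (at level 80, right associativity) : form_scope.
Notation "p ∨ q" := (Or p q) (at level 85, right associativity) : form_scope.
Notation "p ⇒ q" := (Imp p q) (at level 90, right associativity) : form_scope.
Notation "p ⇔ q" := (Iff p q) (at level 95, no associativity) : form_scope.
Notation "∀ x , p" := (All (fun x => p))
  (at level 200, x name, p at level 200) : form_scope.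
Notation "∃ x , p" := (Ex (fun x => p))
  (at level 200, x name, p at level 200) : form_scope.
Notation "∀ x ∈ a , p" := (All (fun x => Imp (Mem x a) p))
  (at level 200, x name, a at level 69, p at level 200) : form_scope.
Notation "∃ x ∈ a , p" := (Ex (fun x => And (Mem x a) p))
  (at level 200, x name, a at level 69, p at level 200) : form_scope.

Local Open Scope form_scope.

Definition subset {T} (x y : T) : form T := ∀ z ∈ x, z ∈ y.

Definition empty {T} (x : T) : form T := ∀ z, ¬ z ∈ x.

Definition upair {T} (x y z : T) : form T := ∀ u, u ∈ z ⇔ (u ≐ x ∨ u ≐ y).

(** [p = (x, y)] (Kuratowski) *)
Definition is_pair {T} (x y p : T) : form T :=
  ∀ z, z ∈ p ⇔ (upair x x z ∨ upair x y z).

(** [y = x ∪ {x}] *)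
Definition is_succ {T} (x y : T) : form T := ∀ u, u ∈ y ⇔ (u ∈ x ∨ u ≐ x).

Definition is_power {T} (x p : T) : form T := ∀ u, u ∈ p ⇔ subset u x.

(** [(x, y) ∈ r] *)
Definition rel {T} (r x y : T) : form T := ∃ p ∈ r, is_pair x y p.

Definition rel_between {T} (r a b : T) : form T :=
  ∀ p ∈ r, ∃ x ∈ a, ∃ y ∈ b, is_pair x y p.

(** [f] is a function with domain [a]; then [rel f x y] reads [f(x) = y] *)
Definition fun_on {T} (f a : T) : form T :=
  (∀ p ∈ f, ∃ x ∈ a, ∃ y, is_pair x y p) ∧
  (∀ x ∈ a, ∃ y, rel f x y ∧ (∀ y', rel f x y' ⇒ y' ≐ y)).

Definition fun_to {T} (f a b : T) : form T :=
  fun_on f a ∧ (∀ x ∈ a, ∀ y, rel f x y ⇒ y ∈ b).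

Definition bijection {T} (f a b : T) : form T :=
  fun_to f a b ∧
  (∀ x, ∀ x', ∀ y, rel f x y ∧ rel f x' y ⇒ x ≐ x') ∧
  (∀ y ∈ b, ∃ x ∈ a, rel f x y).

Definition equipotent {T} (a b : T) : form T := ∃ f, bijection f a b.

Definition transitive {T} (x : T) : form T := ∀ y ∈ x, subset y x.

(** Transitive and linearly ordered by membership; well-ordering follows since
    membership is well-founded. *)
Definition ordinal {T} (x : T) : form T :=
  transitive x ∧ (∀ y ∈ x, ∀ z ∈ x, y ∈ z ∨ y ≐ z ∨ z ∈ y).

Definition limit {T} (d : T) : form T :=
  ordinal d ∧ ¬ empty d ∧ (∀ b ∈ d, ∃ c ∈ d, b ∈ c).

Definition is_omega {T} (w : T) : form T := limit w ∧ (∀ n ∈ w, ¬ limit n).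

Definition cardinal {T} (k : T) : form T :=
  ordinal k ∧ (∀ a ∈ k, ¬ equipotent a k).

Definition regular {T} (k : T) : form T :=
  ∀ a ∈ k, ∀ f, fun_to f a k ⇒
    (∃ b ∈ k, ∀ x ∈ a, ∀ y, rel f x y ⇒ y ∈ b).

Definition strong_limit {T} (k : T) : form T :=
  ∀ l ∈ k, cardinal l ⇒
    (∃ p, ∃ m ∈ k, is_power l p ∧ cardinal m ∧ equipotent p m).

Definition inaccessible {T} (k : T) : form T :=
  cardinal k ∧ (∃ w ∈ k, is_omega w) ∧ regular k ∧ strong_limit k.

(** [rank(x) = r], where [rank(y) = sup {rank(z) + 1 : z ∈ y}]; the recursion
    is carried out on a transitive set [t] containing [x]. *)
Definition is_rank {T} (x r : T) : form T :=
  ∃ t, ∃ f, transitive t ∧ x ∈ t ∧ fun_on f t ∧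
    (∀ y ∈ t, ∀ v, rel f y v ⇒
       (∀ d, d ∈ v ⇔ (∃ z ∈ y, ∃ u, rel f z u ∧ (d ∈ u ∨ d ≐ u)))) ∧
    rel f x r.

Definition rank_lt {T} (x k : T) : form T := ∃ r ∈ k, is_rank x r.

Definition is_R {T} (k a : T) : form T := ∀ x, x ∈ a ⇔ rank_lt x k.

Definition club {T} (c k : T) : form T :=
  subset c k ∧
  (∀ a ∈ k, ∃ b ∈ c, a ∈ b) ∧
  (∀ d ∈ k, limit d ∧ (∀ a ∈ d, ∃ b ∈ c, b ∈ d ∧ a ∈ b) ⇒ d ∈ c).

Definition subtle {T} (k : T) : form T :=
  inaccessible k ∧
  (∀ s, ∀ c,
     fun_on s k ∧ (∀ a ∈ k, ∀ sa, rel s a sa ⇒ subset sa a) ∧ club c k ⇒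
     (∃ b ∈ c, ∃ g ∈ c, b ∈ g ∧
        (∃ sb, ∃ sg, rel s b sb ∧ rel s g sg ∧
           (∀ x, x ∈ sb ⇔ (x ∈ sg ∧ x ∈ b))))).

(** Internal first-order logic: the object language has equality, a
    binary symbol E and a unary symbol S.  Its formulas are coded by sets, so that elementarity is itself a notion of
    set theory, which can be evaluated inside [R(theta)]. *)

Fixpoint numeral {T} (n : nat) (x : T) : form T :=
  match n with
  | O => empty x
  | S n => ∃ y, numeral n y ∧ is_succ y x
  end.

(** [c = (n, (x, y))]. The codes are:
    [(0, (i, j))] for [v_i E v_j],    [(1, (i, j))] for [v_i = v_j],
    [(2, (i, i))] for [S(v_i)],       [(3, (p, p))] for the negation of [p],
    [(4, (p, q))] for [p] and [q],    [(5, (i, p))] for [exists v_i, p]. *)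
Definition code {T} (n : nat) (x y c : T) : form T :=
  ∃ k, ∃ q, numeral n k ∧ is_pair x y q ∧ is_pair k q c.

Definition formula_closed {T} (w X : T) : form T :=
  (∀ i ∈ w, ∀ j ∈ w, ∀ c,
     code 0 i j c ∨ code 1 i j c ∨ code 2 i i c ⇒ c ∈ X) ∧
  (∀ p ∈ X, ∀ c, code 3 p p c ⇒ c ∈ X) ∧
  (∀ p ∈ X, ∀ q ∈ X, ∀ c, code 4 p q c ⇒ c ∈ X) ∧
  (∀ i ∈ w, ∀ p ∈ X, ∀ c, code 5 i p c ⇒ c ∈ X).

(** [F] is the set of all formulas, the variables being indexed by [w] *)
Definition is_formulas {T} (w F : T) : form T :=
  formula_closed w F ∧ (∀ X, formula_closed w X ⇒ subset F X).

(** [s' = s[i := a]], for assignments [s], [s'] with domain [w] *)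
Definition updates {T} (w s i a s' : T) : form T :=
  ∀ j ∈ w, (j ≐ i ⇒ rel s' j a) ∧
           (¬ j ≐ i ⇒ (∀ x, rel s' j x ⇔ rel s j x)).

(** [Z] is the satisfaction relation of the structure [(A, E, P)]: [rel Z p s]
    iff [p] holds in it under the assignment [s : w -> A] (Tarski's clauses). *)
Definition is_satisfaction {T} (w F A E P Z : T) : form T :=
  ∀ s, fun_to s w A ⇒
    (∀ i ∈ w, ∀ j ∈ w, ∀ c,
       (code 0 i j c ⇒
          (rel Z c s ⇔ (∃ x, ∃ y, rel s i x ∧ rel s j y ∧ rel E x y))) ∧
       (code 1 i j c ⇒
          (rel Z c s ⇔ (∃ x, rel s i x ∧ rel s j x))) ∧
       (code 2 i i c ⇒
          (rel Z c s ⇔ (∃ x, rel s i x ∧ x ∈ P)))) ∧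
    (∀ p ∈ F, ∀ c, code 3 p p c ⇒ (rel Z c s ⇔ ¬ rel Z p s)) ∧
    (∀ p ∈ F, ∀ q ∈ F, ∀ c, code 4 p q c ⇒
       (rel Z c s ⇔ (rel Z p s ∧ rel Z q s))) ∧
    (∀ i ∈ w, ∀ p ∈ F, ∀ c, code 5 i p c ⇒
       (rel Z c s ⇔
          (∃ a ∈ A, ∃ s', fun_to s' w A ∧ updates w s i a s' ∧ rel Z p s'))).

Definition is_structure {T} (A E P : T) : form T :=
  rel_between E A A ∧ subset P A.

(** [(B, F, Q)] is an elementary extension of [(A, E, P)] *)
Definition elementary {T} (A E P B F Q : T) : form T :=
  subset A B ∧
  (∃ w, ∃ L, ∃ Z, ∃ Z',
     is_omega w ∧ is_formulas w L ∧
     is_satisfaction w L A E P Z ∧ is_satisfaction w L B F Q Z' ∧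
     (∀ p ∈ L, ∀ s, fun_to s w A ⇒ (rel Z p s ⇔ rel Z' p s))).

(** [(B, F, Q)] is an end elementary extension of [(A, E, P)] *)
Definition eee {T} (A E P B F Q : T) : form T :=
  elementary A E P B F Q ∧
  (∃ b ∈ B, ¬ b ∈ A) ∧
  (∀ a ∈ A, ∀ b, (b ∈ A ∧ rel E b a) ⇔ (b ∈ B ∧ rel F b a)).

Definition well_founded_rel {T} (B F : T) : form T :=
  ∀ X, subset X B ∧ ¬ empty X ⇒ (∃ m ∈ X, ∀ y ∈ X, ¬ rel F y m).

(** [h] is the Mostowski collapse of [(B, F)]: [h(x) = {h(y) : y F x}] *)
Definition is_collapse {T} (B F h : T) : form T :=
  fun_on h B ∧
  (∀ x ∈ B, ∀ v, rel h x v ⇒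
     (∀ u, u ∈ v ⇔ (∃ y ∈ B, rel F y x ∧ rel h y u))).

(** [o] is the ordinal height of the well-founded structure [(B, F)]: the set
    of the ordinals that belong to its transitive collapse. *)
Definition is_height {T} (B F o : T) : form T :=
  ∃ h, is_collapse B F h ∧
    (∀ d, d ∈ o ⇔ (ordinal d ∧ (∃ x ∈ B, rel h x d))).

(** [E] is the membership relation of [A], as a set of pairs *)
Definition is_membership {T} (A E : T) : form T :=
  ∀ p, p ∈ E ⇔ (∃ x ∈ A, ∃ y ∈ A, x ∈ y ∧ is_pair x y p).

Definition unfoldable {T} (k : T) : form T :=
  inaccessible k ∧
  (∃ A, ∃ E, is_R k A ∧ is_membership A E ∧
     (∀ a, ∀ S, ordinal a ∧ subset S A ⇒
        (∃ B, ∃ F, ∃ Q,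
           is_structure B F Q ∧ eee A E S B F Q ∧ well_founded_rel B F ∧
           (∃ o, is_height B F o ∧ subset a o)))).

Definition R (theta : V) : Type := {x : V | sat mem (rank_lt x theta)}.

Definition R_mem (theta : V) (x y : R theta) : Prop :=
  mem (proj1_sig x) (proj1_sig y).

(* Main.v *)
Require Import Defs.
From Stdlib Require Import Classical ClassicalEpsilon FunctionalExtensionality
  PropExtensionality Wellfounded.

(** Suppose that no [kappa < theta] is unfoldable in [R(theta)].  Every
    inaccessible [kappa < theta] then has a counterexample: an ordinal [a_kappa]
    and a subset [S_kappa] of [R(kappa)] such that [(R(kappa), E, S_kappa)] has no
    well-founded end elementary extension of height at least [a_kappa].  Attach to
    such a [kappa] the satisfaction relation [Z_kappa] of [(R(kappa), E, S_kappa)],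
    and to a singular [kappa] a map witnessing its singularity, tagged with its
    domain.  The data attached to [kappa] can be coded by a subset of [kappa], for
    all [kappa] in a club, by means of a well-ordering of [R(theta)].  Subtlety
    yields [beta < gamma], both closed under [kappa |-> a_kappa] and under
    cardinalities of power sets, whose data agree on [R(beta)]
    ([subtle_hierarchy]).

    If [beta] is singular, so is [gamma], with the same witness: its values lie
    below [beta], so it is not cofinal in [gamma], a contradiction.  So [beta] and
    [gamma] are inaccessible.  Since codes of formulas and assignments
    [omega -> R(beta)] belong to [R(beta)], the agreement of [Z_beta] with
    [Z_gamma] on [R(beta)] says that [(R(gamma), E, S_gamma)] is an elementary
    extension of [(R(beta), E, S_beta)] ([coherent_extension]).  It is an end
    extension, and its height [gamma] exceeds [a_beta]: a contradiction
    ([unfoldable_exists]).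

    The hypothesis speaks about the universe of all sets, the conclusion about
    [R(theta)].  Both are instances of [model], a second-order version of the
    axioms of set theory, and the argument above takes place in an arbitrary
    model in which the class of ordinals is subtle, in the second-order sense of
    [ord_subtle].  In a model, every function of the metatheory restricts on each
    set to a function which is a set, so all the formulas involved get the meaning
    that one expects (the lemmas [sat_...]), and the only formulas to be compared
    between the two models are those defining ordinals and limit ordinals.  That [R(theta)] is a
    model rests on the fact that, [theta] being regular and a strong limit, a map
    to [theta] from a set of rank below [theta] is bounded
    ([inaccessible_replacement]). *)

(** * Second-order models of set theory *)

(** Replacement quantifies over all relations of the metatheory; this is what
    makes separation available for arbitrary predicates, and power sets full. *)
Record model {U : Type} (E : U -> U -> Prop) : Prop := {
  model_ext : forall a b, (forall x, E x a <-> E x b) -> a = b;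
  model_wf : well_founded E;
  model_repl : forall a (P : U -> U -> Prop),
    (forall x y y', E x a -> P x y -> P x y' -> y = y') ->
    exists b, forall y, E y b <-> exists x, E x a /\ P x y;
  model_union : forall a, exists b, forall x,
    E x b <-> exists y, E y a /\ E x y;
  model_power : forall a, exists b, forall x,
    E x b <-> forall z, E z x -> E z a;
  model_inf : exists w, (exists x, E x w /\ forall z, ~ E z x) /\
    forall x, E x w -> exists y, E y w /\ forall u, E u y <-> E u x \/ u = x }.

Lemma choice {A B : Type} (P : A -> B -> Prop) :
  (forall x, exists y, P x y) -> exists f, forall x, P x (f x).
Proof.
  intros H; exists (fun x => proj1_sig (constructive_indefinite_description _ (H x))).
  intros x; apply proj2_sig.
Qed.

(** The recursion is stated for a functional on total functions, which is more
    convenient to use than one on functions defined on predecessors only. *)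
Lemma wf_recursion {A B : Type} (R : A -> A -> Prop) (wfR : well_founded R)
    (d : B) (G : A -> (A -> B) -> B) :
  (forall x g h, (forall y, R y x -> g y = h y) -> G x g = G x h) ->
  exists f, forall x, f x = G x f.
Proof.
  intros HG.
  pose (F := fun (x : A) (rec : forall y, R y x -> B) =>
    G x (fun y => match excluded_middle_informative (R y x) with
                  | left h => rec y h | right _ => d end)).
  exists (Fix wfR (fun _ => B) F); intros x.
  rewrite Fix_eq.
  - unfold F at 1. apply HG; intros y Hy.
    destruct (excluded_middle_informative (R y x)); [reflexivity | contradiction].
  - intros x' g h Hgh. unfold F. apply HG; intros y _.
    destruct (excluded_middle_informative (R y x')); auto.
Qed.

Section Theory.
Context {U : Type} {E : U -> U -> Prop} (M : model E).

Local Notation "x ∈ y" := (E x y) (at level 70, no associativity).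
Local Notation Ord x := (sat E (ordinal x)).
Local Notation Lim x := (sat E (limit x)).

Lemma model_inhabited : inhabited U.
Proof. destruct (model_inf E M) as [w _]; exact (inhabits w). Qed.

Definition small (P : U -> Prop) : Prop := exists b, forall y, y ∈ b <-> P y.

(** The set with extension [P]; meaningful only for [small P]. *)
Definition set_of (P : U -> Prop) : U :=
  epsilon model_inhabited (fun b => forall y, y ∈ b <-> P y).

Lemma set_ofE P : small P -> forall y, y ∈ set_of P <-> P y.
Proof. intros H; exact (epsilon_spec model_inhabited _ H). Qed.

Lemma small_sep (P : U -> Prop) a : (forall y, P y -> y ∈ a) -> small P.
Proof.
  intros H. destruct (model_repl E M a (fun x y => x = y /\ P x)) as [b Hb].
  - intros x y y' _ [<- _] [<- _]; reflexivity.
  - exists b; intros y; rewrite Hb; split.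
    + intros (x & _ & <- & Hx); exact Hx.
    + intros Hy; exists y; auto.
Qed.

Lemma small_image (f : U -> U) a : small (fun y => exists x, x ∈ a /\ y = f x).
Proof.
  destruct (model_repl E M a (fun x y => y = f x)) as [b Hb].
  - intros; congruence.
  - exists b; exact Hb.
Qed.

Definition image (f : U -> U) a := set_of (fun y => exists x, x ∈ a /\ y = f x).

Lemma imageE f a y : y ∈ image f a <-> exists x, x ∈ a /\ y = f x.
Proof. apply (set_ofE _ (small_image f a)). Qed.

Lemma in_image f a x : x ∈ a -> f x ∈ image f a.
Proof. rewrite imageE; eauto. Qed.

Lemma small_union (f : U -> U) a : small (fun y => exists x, x ∈ a /\ y ∈ f x).
Proof.
  destruct (model_union E M (image f a)) as [b Hb].
  exists b; intros y; rewrite Hb; split.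
  - intros (z & Hz & Hy). apply imageE in Hz as (x & Hx & ->); eauto.
  - intros (x & Hx & Hy); exists (f x); split; auto using in_image.
Qed.

Definition union_of (f : U -> U) a := set_of (fun y => exists x, x ∈ a /\ y ∈ f x).

Lemma union_ofE f a y : y ∈ union_of f a <-> exists x, x ∈ a /\ y ∈ f x.
Proof. apply (set_ofE _ (small_union f a)). Qed.

Definition pow a := set_of (fun x => forall z, z ∈ x -> z ∈ a).

Lemma powE a x : x ∈ pow a <-> forall z, z ∈ x -> z ∈ a.
Proof. apply (set_ofE _ (model_power E M a)). Qed.

Definition emp := set_of (fun _ => False).

Lemma empE x : ~ x ∈ emp.
Proof.
  destruct model_inhabited as [a].
  intros H; apply (set_ofE (fun _ => False)) in H; [exact H |].
  apply (small_sep _ a); tauto.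
Qed.

Lemma small_pair a b : small (fun z => z = a \/ z = b).
Proof.
  (* Replace the two elements [emp] and [pow emp] of [pow (pow emp)]. *)
  destruct (model_repl E M (pow (pow emp))
    (fun x y => x = emp /\ y = a \/ x <> emp /\ y = b)) as [c Hc].
  - intros x y y' _ [[]|[]] [[]|[]]; congruence.
  - exists c; intros y; rewrite Hc; split; [intuition; destruct H; tauto |].
    assert (He : emp ∈ pow emp) by (apply powE; auto).
    intros [-> | ->].
    + exists emp; split; [| auto].
      apply powE; intros z Hz; now apply empE in Hz.
    + exists (pow emp); split; [apply powE; auto |].
      right; split; [| auto].
      intros H; rewrite H in He; now apply empE in He.
Qed.

Definition pair a b := set_of (fun z => z = a \/ z = b).

Lemma pairE a b z : z ∈ pair a b <-> z = a \/ z = b.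
Proof. apply (set_ofE _ (small_pair a b)). Qed.

Definition succ a := set_of (fun u => u ∈ a \/ u = a).

Lemma succE a u : u ∈ succ a <-> u ∈ a \/ u = a.
Proof.
  apply set_ofE. exists (union_of (fun x => x) (pair a (pair a a))).
  intros y; rewrite union_ofE; split.
  - intros (x & Hx & Hy); apply pairE in Hx as [-> | ->]; [auto |].
    apply pairE in Hy; tauto.
  - intros [Hy | ->]; [exists a | exists (pair a a)];
      split; auto; apply pairE; auto.
Qed.

Definition opair x y := pair (pair x x) (pair x y).

Lemma ext a b : (forall x, x ∈ a <-> x ∈ b) -> a = b.
Proof. apply (model_ext E M). Qed.

Lemma pair_inj a b c d : pair a b = pair c d ->
  a = c /\ b = d \/ a = d /\ b = c.
Proof.
  intros H.
  assert (Ha : a ∈ pair c d) by (rewrite <- H; apply pairE; auto).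
  assert (Hb : b ∈ pair c d) by (rewrite <- H; apply pairE; auto).
  assert (Hc : c ∈ pair a b) by (rewrite H; apply pairE; auto).
  assert (Hd : d ∈ pair a b) by (rewrite H; apply pairE; auto).
  apply pairE in Ha, Hb, Hc, Hd. intuition congruence.
Qed.

Lemma opair_inj a b c d : opair a b = opair c d -> a = c /\ b = d.
Proof.
  intros H; apply pair_inj in H as [[H1 H2] | [H1 H2]];
    apply pair_inj in H1, H2; intuition congruence.
Qed.

Lemma opair_not_emp x y : opair x y <> emp.
Proof.
  intros H; apply (empE (pair x x)); rewrite <- H; apply pairE; auto.
Qed.

Lemma mem_irrefl x : ~ x ∈ x.
Proof.
  induction x as [x IH] using (well_founded_ind (model_wf E M)).
  intros H; exact (IH x H H).
Qed.

Lemma mem_asym x : forall y, x ∈ y -> ~ y ∈ x.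
Proof.
  induction x as [x IH] using (well_founded_ind (model_wf E M)).
  intros y H H'; exact (IH y H' x H' H).
Qed.

Lemma mem_no_3cycle x : forall y z, x ∈ y -> y ∈ z -> ~ z ∈ x.
Proof.
  induction x as [x IH] using (well_founded_ind (model_wf E M)).
  intros y z H H' H''; exact (IH z H'' x y H'' H H').
Qed.

(** * Ordinals *)

Lemma Ord_trans a : Ord a -> forall x y, x ∈ a -> y ∈ x -> y ∈ a.
Proof. intros [H _] x y Hx; exact (H x Hx y). Qed.

Lemma Ord_in a x : Ord a -> x ∈ a -> Ord x.
Proof.
  intros [Ht Hl] Hx; split.
  - intros y Hy z Hz.
    assert (Hya : y ∈ a) by exact (Ht x Hx y Hy).
    assert (Hza : z ∈ a) by exact (Ht y Hya z Hz).
    destruct (Hl z Hza x Hx) as [H | [H | H]]; [exact H | |].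
    + cbn in H; subst z; destruct (mem_asym x y Hz Hy).
    + destruct (mem_no_3cycle x z y H Hz Hy).
  - intros y Hy z Hz; apply Hl; eapply Ht; eauto.
Qed.

(** Double induction: if neither of [a], [b] belongs to the other, then by the
    induction hypotheses they have the same elements. *)
Lemma Ord_total a : forall b, Ord a -> Ord b -> a ∈ b \/ a = b \/ b ∈ a.
Proof.
  induction a as [a IHa] using (well_founded_ind (model_wf E M)).
  induction b as [b IHb] using (well_founded_ind (model_wf E M)).
  intros Ha Hb.
  destruct (classic (a ∈ b)) as [|Hab]; [auto |].
  destruct (classic (b ∈ a)) as [|Hba]; [auto |].
  right; left; apply ext; intros x; split; intros Hx.
  - destruct (IHa x Hx b (Ord_in a x Ha Hx) Hb) as [H | [-> | H]];
      [auto | contradiction |].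
    destruct Hba; exact (Ord_trans a Ha x b Hx H).
  - destruct (IHb x Hx Ha (Ord_in b x Hb Hx)) as [H | [<- | H]];
      [| contradiction | auto].
    destruct Hab; exact (Ord_trans b Hb x a Hx H).
Qed.

Lemma Ord_of_Ords a : (forall x, x ∈ a -> Ord x) ->
  (forall x y, x ∈ a -> y ∈ x -> y ∈ a) -> Ord a.
Proof.
  intros H1 H2; split.
  - intros x Hx y; exact (H2 x y Hx).
  - intros x Hx y Hy; apply Ord_total; auto.
Qed.

Lemma Ord_sub a b : Ord a -> Ord b -> (forall x, x ∈ a -> x ∈ b) ->
  a ∈ b \/ a = b.
Proof.
  intros Ha Hb H; destruct (Ord_total a b Ha Hb) as [|[|H']]; auto.
  destruct (mem_irrefl b (H b H')).
Qed.

Lemma Ord_succ a : Ord a -> Ord (succ a).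
Proof.
  intros Ha; apply Ord_of_Ords.
  - intros x Hx; apply succE in Hx as [Hx | ->]; eauto using Ord_in.
  - intros x y Hx Hy; apply succE; apply succE in Hx as [Hx | ->]; [|auto].
    left; eauto using Ord_trans.
Qed.

Lemma Ord_union_of f a : (forall x, x ∈ a -> Ord (f x)) -> Ord (union_of f a).
Proof.
  intros H; apply Ord_of_Ords.
  - intros y Hy; apply union_ofE in Hy as (x & Hx & Hy); eauto using Ord_in.
  - intros y z Hy Hz; apply union_ofE in Hy as (x & Hx & Hy).
    apply union_ofE; exists x; split; eauto using Ord_trans.
Qed.

Lemma Ord_emp : Ord emp.
Proof. apply Ord_of_Ords; intros x; [|intros y]; intros H; now apply empE in H. Qed.

(** The Burali-Forti paradox. *)
Lemma Ords_not_small : ~ small (fun x => Ord x).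
Proof.
  intros [a Ha]. assert (Hord : Ord a).
  { apply Ord_of_Ords; [intros x; apply Ha |].
    intros x y Hx Hy; apply Ha; apply Ha in Hx; eauto using Ord_in. }
  apply (mem_irrefl a), Ha, Hord.
Qed.

Lemma Lim_Ord a : Lim a -> Ord a.
Proof. now intros [H _]. Qed.

Lemma Lim_next a x : Lim a -> x ∈ a -> exists y, y ∈ a /\ x ∈ y.
Proof. intros (_ & _ & H) Hx; destruct (H x Hx) as (y & Hy & Hxy); eauto. Qed.

Lemma Lim_succ a x : Lim a -> x ∈ a -> succ x ∈ a.
Proof.
  intros Ha Hx; pose proof (Lim_Ord a Ha) as Ho.
  destruct (Lim_next a x Ha Hx) as (y & Hy & Hxy).
  assert (Hoy : Ord y) by eauto using Ord_in.
  destruct (Ord_sub (succ x) y) as [H | ->]; auto.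
  - apply Ord_succ; eauto using Ord_in.
  - intros z Hz; apply succE in Hz as [Hz | ->]; eauto using Ord_trans.
  - eauto using Ord_trans.
Qed.

Lemma Lim_max a x y : Lim a -> x ∈ a -> y ∈ a ->
  exists z, z ∈ a /\ x ∈ z /\ y ∈ z.
Proof.
  intros Ha Hx Hy; pose proof (Lim_Ord a Ha) as Ho.
  destruct (Ord_total x y) as [H | [<- | H]]; eauto using Ord_in.
  - exists (succ y); repeat split; auto using Lim_succ; apply succE; auto.
  - exists (succ x); repeat split; auto using Lim_succ; apply succE; auto.
  - exists (succ x); repeat split; auto using Lim_succ; apply succE; auto.
Qed.

Lemma Lim_intro a x : Ord a -> x ∈ a ->
  (forall y, y ∈ a -> exists z, z ∈ a /\ y ∈ z) -> Lim a.
Proof.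
  intros Ha Hx H; split; [exact Ha | split].
  - intros H'; exact (H' x Hx).
  - exact H.
Qed.

Lemma Lim_emp a : Lim a -> emp ∈ a.
Proof.
  intros Ha; pose proof (Lim_Ord a Ha) as Ho.
  destruct (Ord_total emp a Ord_emp Ho) as [H | [H | H]]; auto.
  - destruct Ha as (_ & H' & _); destruct H'; intros z; cbn.
    rewrite <- H; apply empE.
  - now apply empE in H.
Qed.

(** * Rank and the cumulative hierarchy *)

Lemma rank_exists : exists f : U -> U, forall x, f x = union_of (fun y => succ (f y)) x.
Proof.
  apply (wf_recursion E (model_wf E M) emp (fun x f => union_of (fun y => succ (f y)) x)).
  intros x g h H; apply ext; intros z; rewrite !union_ofE.
  split; intros (y & Hy & Hz); exists y; split; auto.
  - now rewrite <- H.
  - now rewrite H.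
Qed.

Definition rank : U -> U :=
  proj1_sig (constructive_indefinite_description _ rank_exists).

Lemma rankE x d : d ∈ rank x <-> exists y, y ∈ x /\ (d ∈ rank y \/ d = rank y).
Proof.
  unfold rank; destruct constructive_indefinite_description as [f Hf]; cbn.
  rewrite Hf, union_ofE. split; intros (y & Hy & Hd); exists y; split; auto.
  - now apply succE.
  - now apply succE.
Qed.

Lemma rank_mem x y : x ∈ y -> rank x ∈ rank y.
Proof. intros H; apply rankE; eauto. Qed.

Lemma Ord_rank x : Ord (rank x).
Proof.
  induction x as [x IH] using (well_founded_ind (model_wf E M)).
  apply Ord_of_Ords.
  - intros d Hd; apply rankE in Hd as (y & Hy & [Hd | ->]); auto.
    exact (Ord_in (rank y) d (IH y Hy) Hd).
  - intros d c Hd Hc; apply rankE in Hd as (y & Hy & Hd).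
    apply rankE; exists y; split; auto; left.
    destruct Hd as [Hd | ->]; auto. exact (Ord_trans (rank y) (IH y Hy) d c Hd Hc).
Qed.

Lemma rank_Ord a : Ord a -> rank a = a.
Proof.
  induction a as [a IH] using (well_founded_ind (model_wf E M)); intros Ha.
  apply ext; intros d; rewrite rankE; split.
  - intros (y & Hy & Hd). rewrite IH in Hd; eauto using Ord_in.
    destruct Hd as [Hd | ->]; eauto using Ord_trans.
  - intros Hd; exists d; split; auto; right; symmetry; eauto using Ord_in.
Qed.

Lemma rank_bound x b a : Ord a -> b ∈ a ->
  (forall y, y ∈ x -> rank y ∈ b) -> rank x ∈ a.
Proof.
  intros Ha Hb H. assert (Hob : Ord b) by eauto using Ord_in.
  destruct (Ord_sub (rank x) b (Ord_rank x) Hob) as [H' | ->]; auto.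
  - intros d Hd; apply rankE in Hd as (y & Hy & [Hd | ->]); eauto using Ord_trans.
  - eauto using Ord_trans.
Qed.

Lemma rank_sub x y : (forall z, z ∈ x -> z ∈ y) -> rank x ∈ succ (rank y).
Proof.
  intros H; apply (rank_bound x (rank y)).
  - apply Ord_succ, Ord_rank.
  - apply succE; auto.
  - auto using rank_mem.
Qed.

(** By induction: a set of rank [b < a] is a subset of the set of sets of rank
    less than [b]. *)
Lemma small_rank a : Ord a -> small (fun x => rank x ∈ a).
Proof.
  induction a as [a IH] using (well_founded_ind (model_wf E M)); intros Ha.
  apply (small_sep _ (union_of (fun b => pow (set_of (fun x => rank x ∈ b))) a)).
  intros x Hx; apply union_ofE; exists (rank x); split; auto.
  apply powE; intros y Hy; apply set_ofE; auto using Ord_rank, rank_mem.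
Qed.

Definition Vs a := set_of (fun x => rank x ∈ a).

Lemma VsE a : Ord a -> forall x, x ∈ Vs a <-> rank x ∈ a.
Proof. intros Ha; exact (set_ofE _ (small_rank a Ha)). Qed.

Lemma Vs_trans a x y : Ord a -> x ∈ Vs a -> y ∈ x -> y ∈ Vs a.
Proof.
  intros Ha Hx Hy; apply VsE in Hx; auto; apply VsE; eauto using Ord_trans, rank_mem.
Qed.

Lemma small_sub_rank (P : U -> Prop) a :
  Ord a -> (forall x, P x -> rank x ∈ a) -> small P.
Proof. intros Ha H; apply (small_sep _ (Vs a)); intros y Hy; apply VsE; auto. Qed.

Lemma Ord_bound f a : exists b, Ord b /\ forall x, x ∈ a -> Ord (f x) -> f x ∈ b.
Proof.
  exists (rank (image f a)); split; [apply Ord_rank |].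
  intros x Hx Ho; rewrite <- (rank_Ord (f x) Ho); auto using rank_mem, in_image.
Qed.

Lemma rank_pair a x y : Lim a -> rank x ∈ a -> rank y ∈ a -> rank (pair x y) ∈ a.
Proof.
  intros Ha Hx Hy; destruct (Lim_max a (rank x) (rank y)) as (z & Hz & Hxz & Hyz); auto.
  apply (rank_bound _ z); auto using Lim_Ord.
  intros u Hu; apply pairE in Hu as [-> | ->]; auto.
Qed.

Lemma rank_opair a x y : Lim a -> rank x ∈ a -> rank y ∈ a -> rank (opair x y) ∈ a.
Proof. intros; unfold opair; auto using rank_pair. Qed.

Lemma rank_in_pair_l x y : rank x ∈ rank (pair x y).
Proof. apply rank_mem, pairE; auto. Qed.

Lemma rank_in_pair_r x y : rank y ∈ rank (pair x y).
Proof. apply rank_mem, pairE; auto. Qed.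

Lemma rank_trans x y z : rank x ∈ rank y -> rank y ∈ rank z -> rank x ∈ rank z.
Proof. intros; eapply (Ord_trans (rank z)); eauto using Ord_rank. Qed.

Lemma rank_in_opair_l x y : rank x ∈ rank (opair x y).
Proof. eapply rank_trans; [apply (rank_in_pair_l x x) | apply rank_in_pair_l]. Qed.

Lemma rank_in_opair_r x y : rank y ∈ rank (opair x y).
Proof. eapply rank_trans; [apply (rank_in_pair_r x y) | apply rank_in_pair_r]. Qed.

(** * Natural numbers *)

Fixpoint num (n : nat) : U := match n with O => emp | S n => succ (num n) end.

Lemma small_num : small (fun x => exists n, x = num n).
Proof.
  destruct (model_inf E M) as (w & (z & Hz & Hz') & Hs).
  apply (small_sep _ w); intros y [n ->]; induction n as [|n IH]; cbn.
  - replace emp with z; auto. apply ext; intros x; split; intros H.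
    + destruct (Hz' x H).
    + now apply empE in H.
  - destruct (Hs _ IH) as (y & Hy & Hy').
    replace (succ (num n)) with y; auto.
    apply ext; intros x; rewrite Hy', succE; tauto.
Qed.

Definition omega := set_of (fun x => exists n, x = num n).

Lemma omegaE x : x ∈ omega <-> exists n, x = num n.
Proof. apply (set_ofE _ small_num). Qed.

Lemma Ord_num n : Ord (num n).
Proof. induction n; [apply Ord_emp | now apply Ord_succ]. Qed.

Lemma Lim_omega : Lim omega.
Proof.
  apply (Lim_intro _ emp).
  - apply Ord_of_Ords.
    + intros x Hx; apply omegaE in Hx as [n ->]; apply Ord_num.
    + intros x y Hx; apply omegaE in Hx as [n ->]; revert y.
      induction n as [|n IH]; cbn; intros y Hy; [now apply empE in Hy |].
      apply succE in Hy as [Hy | ->]; auto. apply omegaE; eauto.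
  - apply omegaE; exists 0; auto.
  - intros y Hy; apply omegaE in Hy as [n ->]; exists (num (S n)); split.
    + apply omegaE; eauto.
    + apply succE; auto.
Qed.

Lemma num_not_Lim n : ~ Lim (num n).
Proof.
  intros H; destruct n as [|n].
  - now apply Lim_emp, empE in H.
  - apply (mem_irrefl (num (S n))), Lim_succ; auto.
    apply succE; auto.
Qed.

Lemma sat_is_omega : sat E (is_omega omega).
Proof.
  split; [exact Lim_omega |].
  intros n Hn; apply omegaE in Hn as [k ->]; apply num_not_Lim.
Qed.

Lemma num_lt n m : n < m -> num n ∈ num m.
Proof. induction 1; cbn; apply succE; auto. Qed.

Lemma num_inj n m : num n = num m -> n = m.
Proof.
  intros H; destruct (PeanoNat.Nat.lt_total n m) as [Hl | [Hl | Hl]]; auto;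
    apply num_lt in Hl; rewrite H in Hl; now apply mem_irrefl in Hl.
Qed.

Lemma small_seq (f : nat -> U) : small (fun y => exists n, y = f n).
Proof.
  destruct (model_repl E M omega (fun x y => exists n, x = num n /\ y = f n)) as [b Hb].
  - intros x y y' _ (n & -> & ->) (m & H & ->); now apply num_inj in H as ->.
  - exists b; intros y; rewrite Hb; split.
    + intros (x & _ & n & _ & ->); eauto.
    + intros (n & ->); exists (num n); split; [apply omegaE |]; eauto.
Qed.

(** * Set functions and functions of the metatheory *)

Lemma wf_minimal (P : U -> Prop) x : P x -> exists y, P y /\ forall z, z ∈ y -> ~ P z.
Proof.
  induction x as [x IH] using (well_founded_ind (model_wf E M)); intros Hx.
  destruct (classic (exists y, y ∈ x /\ P y)) as [(y & Hy & Hp) | H]; [eauto |].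
  exists x; split; [exact Hx |]; intros z Hz Hp; apply H; eauto.
Qed.

Lemma sat_upair x y z : sat E (upair x y z) <-> z = pair x y.
Proof.
  split.
  - intros H; apply ext; intros u; rewrite pairE; apply H.
  - intros -> u; apply pairE.
Qed.

Lemma sat_pair x y p : sat E (is_pair x y p) <-> p = opair x y.
Proof.
  split.
  - intros H; apply ext; intros u; unfold opair; rewrite pairE, <- !sat_upair; apply H.
  - intros -> u. change (u ∈ opair x y <-> sat E (upair x x u) \/ sat E (upair x y u)).
    rewrite !sat_upair; apply pairE.
Qed.

Lemma sat_rel r x y : sat E (rel r x y) <-> opair x y ∈ r.
Proof.
  split.
  - intros (p & Hp & H); apply sat_pair in H as ->; exact Hp.
  - intros H; exists (opair x y); split; [exact H | now apply sat_pair].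
Qed.

(** By [fun_on_elim], every function in the sense of the model arises in this way;
    it is this correspondence that replaces quantification over set functions by
    quantification over [U -> U]. *)
Definition graph (F : U -> U) a := image (fun x => opair x (F x)) a.

Lemma graphE F a x y : opair x y ∈ graph F a <-> x ∈ a /\ y = F x.
Proof.
  unfold graph; rewrite imageE; split.
  - intros (z & Hz & H); apply opair_inj in H as [-> ->]; auto.
  - intros [Hx ->]; eauto.
Qed.

Lemma sat_rel_graph F a x y : sat E (rel (graph F a) x y) <-> x ∈ a /\ y = F x.
Proof. rewrite sat_rel; apply graphE. Qed.

Lemma fun_on_graph F a : sat E (fun_on (graph F a) a).
Proof.
  split.
  - intros p Hp; apply imageE in Hp as (x & Hx & ->).
    exists x; split; [exact Hx | exists (F x); now apply sat_pair].
  - intros x Hx; exists (F x); split.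
    + apply sat_rel_graph; auto.
    + intros y Hy; now apply sat_rel_graph in Hy.
Qed.

Lemma fun_on_elim f a : sat E (fun_on f a) -> exists F, f = graph F a.
Proof.
  intros [H1 H2].
  pose (F := fun x => epsilon model_inhabited (fun y => sat E (rel f x y))).
  assert (HF : forall x, x ∈ a -> opair x (F x) ∈ f /\ forall y, opair x y ∈ f -> y = F x).
  { intros x Hx; destruct (H2 x Hx) as (y & Hy & Hu).
    assert (Hr : sat E (rel f x (F x))).
    { apply (epsilon_spec model_inhabited (fun y => sat E (rel f x y))); exists y; exact Hy. }
    split; [now apply sat_rel |].
    intros z Hz; transitivity y; [apply Hu; now apply sat_rel | symmetry; now apply Hu]. }
  exists F; apply ext; intros p; split.
  - intros Hp; destruct (H1 p Hp) as (x & Hx & y & Hy); apply sat_pair in Hy as ->.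
    apply graphE; split; [exact Hx | now apply (HF x Hx)].
  - intros Hp; apply imageE in Hp as (x & Hx & ->); now apply HF.
Qed.

Lemma fun_to_graph F a b : (forall x, x ∈ a -> F x ∈ b) -> sat E (fun_to (graph F a) a b).
Proof.
  intros H; split; [apply fun_on_graph |].
  intros x Hx y Hy; apply sat_rel_graph in Hy as [_ ->]; now apply H.
Qed.

Lemma fun_to_elim f a b : sat E (fun_to f a b) ->
  exists F, (forall x, x ∈ a -> F x ∈ b) /\ f = graph F a.
Proof.
  intros [H1 H2]; destruct (fun_on_elim f a H1) as [F ->].
  exists F; split; [| reflexivity].
  intros x Hx; apply (H2 x Hx); apply sat_rel_graph; auto.
Qed.

Definition bij a b := exists F G : U -> U,
  (forall x, x ∈ a -> F x ∈ b /\ G (F x) = x) /\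
  (forall y, y ∈ b -> G y ∈ a /\ F (G y) = y).

Lemma bij_sym a b : bij a b -> bij b a.
Proof. intros (F & G & H1 & H2); exists G, F; auto. Qed.

Lemma bij_trans a b c : bij a b -> bij b c -> bij a c.
Proof.
  intros (F & G & H1 & H2) (F' & G' & H1' & H2').
  exists (fun x => F' (F x)), (fun x => G (G' x)); split.
  - intros x Hx; destruct (H1 x Hx) as [Hy Ey], (H1' _ Hy) as [Hz Ez].
    split; [exact Hz | congruence].
  - intros x Hx; destruct (H2' x Hx) as [Hy Ey], (H2 _ Hy) as [Hz Ez].
    split; [exact Hz | congruence].
Qed.

Lemma sat_equipotent a b : sat E (equipotent a b) <-> bij a b.
Proof.
  split.
  - intros (f & Hf & Hi & Hs); apply fun_to_elim in Hf as (F & HF & ->).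
    pose (G := fun y => epsilon model_inhabited (fun x => x ∈ a /\ F x = y)).
    assert (HG : forall y, y ∈ b -> G y ∈ a /\ F (G y) = y).
    { intros y Hy; apply (epsilon_spec model_inhabited (fun x => x ∈ a /\ F x = y)).
      destruct (Hs y Hy) as (x & Hx & Hr); apply sat_rel_graph in Hr as [_ ->]; eauto. }
    exists F, G; split; [| exact HG].
    intros x Hx; split; [auto |]; destruct (HG (F x) (HF x Hx)) as [Hx' Ex].
    apply (Hi (G (F x)) x (F x)); split; apply sat_rel_graph; auto.
  - intros (F & G & H1 & H2); exists (graph F a); split; [| split].
    + apply fun_to_graph; intros x Hx; now apply H1.
    + intros x x' y [Hx Hx']; apply sat_rel_graph in Hx as [Hx ->], Hx' as [Hx' He].
      cbn; rewrite <- (proj2 (H1 x Hx)), <- (proj2 (H1 x' Hx')); congruence.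
    + intros y Hy; destruct (H2 y Hy) as [Hx Ey].
      exists (G y); split; [exact Hx | apply sat_rel_graph; auto].
Qed.

Lemma sat_regular k : sat E (regular k) <->
  forall a F, a ∈ k -> (forall x, x ∈ a -> F x ∈ k) ->
    exists b, b ∈ k /\ forall x, x ∈ a -> F x ∈ b.
Proof.
  split.
  - intros H a F Ha HF.
    destruct (H a Ha (graph F a) (fun_to_graph F a k HF)) as (b & Hb & Hb').
    exists b; split; [exact Hb |]; intros x Hx; apply (Hb' x Hx), sat_rel_graph; auto.
  - intros H a Ha f Hf; apply fun_to_elim in Hf as (F & HF & ->).
    destruct (H a F Ha HF) as (b & Hb & Hb'); exists b; split; [exact Hb |].
    intros x Hx y Hy; apply sat_rel_graph in Hy as [_ ->]; now apply Hb'.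
Qed.

(** The transitive set asked for by the formula can be taken to be a level of the
    hierarchy. *)
Lemma sat_rank x r : sat E (is_rank x r) <-> r = rank x.
Proof.
  split.
  - intros (t & f & Ht & Hx & Hf & Hr & Hxr).
    apply fun_on_elim in Hf as [F ->].
    assert (HF : forall y, y ∈ t -> F y = rank y).
    { intros y; induction y as [y IH] using (well_founded_ind (model_wf E M)); intros Hy.
      assert (Hy' : sat E (rel (graph F t) y (F y))) by (apply sat_rel_graph; auto).
      apply ext; intros d; rewrite rankE; split.
      - intros Hd; apply (Hr y Hy _ Hy' d) in Hd as (z & Hz & u & Hu & Hd).
        exists z; split; [exact Hz |].
        apply sat_rel_graph in Hu as [Hzt ->]; rewrite <- (IH z Hz Hzt); exact Hd.
      - intros (z & Hz & Hd); apply (Hr y Hy _ Hy' d).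
        assert (Hzt : z ∈ t) by exact (Ht y Hy z Hz).
        exists z; split; [exact Hz |]; exists (rank z); split; [| exact Hd].
        apply sat_rel_graph; rewrite IH; auto. }
    apply sat_rel_graph in Hxr as [_ ->]; auto.
  - intros ->. pose proof (Ord_succ _ (Ord_rank x)) as Ho.
    assert (Hx : x ∈ Vs (succ (rank x))) by (apply VsE; [exact Ho | apply succE; auto]).
    exists (Vs (succ (rank x))), (graph rank (Vs (succ (rank x)))).
    split; [| split; [exact Hx | split; [apply fun_on_graph | split]]].
    + intros y Hy z; exact (Vs_trans _ y z Ho Hy).
    + intros y Hy v Hv d; apply sat_rel_graph in Hv as [_ ->]; split.
      * intros Hd; apply rankE in Hd as (z & Hz & Hd); exists z; split; [exact Hz |].
        exists (rank z); split; [| exact Hd].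
        apply sat_rel_graph; split; [eapply Vs_trans |]; eauto.
      * intros (z & Hz & u & Hu & Hd).
        apply sat_rel_graph in Hu as [_ ->]; apply rankE; eauto.
    + now apply sat_rel_graph.
Qed.

Lemma sat_rank_lt x k : sat E (rank_lt x k) <-> rank x ∈ k.
Proof.
  split.
  - intros (r & Hr & H); apply sat_rank in H as ->; exact Hr.
  - intros H; exists (rank x); split; [exact H | now apply sat_rank].
Qed.

Lemma sat_power x p : sat E (is_power x p) <-> p = pow x.
Proof.
  split.
  - intros H; apply ext; intros u; rewrite powE; exact (H u).
  - intros -> u; apply powE.
Qed.

(** * Well-orderings *)

Definition fresh (X : U -> Prop) (f : U -> U) a x := X x /\ forall b, b ∈ a -> x <> f b.

(** Choosing elements of least rank first makes the transfinite enumeration of a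
    proper class exhaust it: otherwise it would embed the ordinals into a level of
    the hierarchy, namely that of a missed element. *)
Definition next (X : U -> Prop) (f : U -> U) a x :=
  fresh X f a x /\ forall y, fresh X f a y -> ~ rank y ∈ rank x.

Lemma next_exists X f a x : fresh X f a x -> exists y, next X f a y.
Proof.
  intros Hx.
  destruct (wf_minimal (fun r => exists y, fresh X f a y /\ r = rank y) (rank x))
    as (r & (y & Hy & ->) & Hmin); [eauto |].
  exists y; split; [exact Hy |]; intros z Hz Hlt; eapply Hmin; eauto.
Qed.

Lemma enum_exists X : exists f, forall a, f a = epsilon model_inhabited (next X f a).
Proof.
  destruct model_inhabited as [d] eqn:Hd; rewrite <- Hd.
  apply (wf_recursion E (model_wf E M) d (fun a f => epsilon model_inhabited (next X f a))).
  intros a g h H; f_equal.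
  assert (Hfr : fresh X g a = fresh X h a).
  { apply functional_extensionality; intros x; apply propositional_extensionality.
    split; intros [Hx Hn]; split; auto; intros b Hb;
      [rewrite <- H | rewrite H]; auto. }
  unfold next; now rewrite Hfr.
Qed.

Definition enum X := proj1_sig (constructive_indefinite_description _ (enum_exists X)).

Lemma enum_next X a x : fresh X (enum X) a x -> next X (enum X) a (enum X a).
Proof.
  intros Hx; apply next_exists in Hx; revert Hx.
  unfold enum; destruct constructive_indefinite_description as [f Hf]; cbn.
  intros Hx; rewrite Hf; exact (epsilon_spec model_inhabited _ Hx).
Qed.

Lemma enum_onto X x : X x -> exists a, Ord a /\ enum X a = x.
Proof.
  intros Hx; apply NNPP; intros Hno.
  assert (Hn : forall a, Ord a -> next X (enum X) a (enum X a)).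
  { intros a Ha; apply (enum_next X a x); split; [exact Hx |].
    intros b Hb ->; apply Hno; eauto using Ord_in. }
  apply Ords_not_small.
  destruct (model_repl E M (Vs (succ (rank x))) (fun y a => Ord a /\ enum X a = y))
    as [s Hs].
  - intros y a b _ [Ha Hya] [Hb Hyb].
    destruct (Ord_total a b Ha Hb) as [H | [H | H]]; [| exact H |].
    + destruct (Hn b Hb) as [[_ H'] _]; destruct (H' a H); congruence.
    + destruct (Hn a Ha) as [[_ H'] _]; destruct (H' b H); congruence.
  - exists s; intros a; rewrite Hs; split; [intros (y & _ & Ha & _); exact Ha |].
    intros Ha; exists (enum X a); split; [| auto].
    apply VsE; [apply Ord_succ, Ord_rank |]; apply succE.
    destruct (Hn a Ha) as [_ H].
    destruct (Ord_total (rank (enum X a)) (rank x)) as [| [|]]; auto using Ord_rank.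
    destruct (H x); [| assumption]; split; [exact Hx |].
    intros b Hb ->; apply Hno; eauto using Ord_in.
Qed.

(** Global choice: the whole model is enumerated along its ordinals. *)
Lemma global_well_order :
  exists e : U -> U, (forall x, Ord (e x)) /\ forall x y, e x = e y -> x = y.
Proof.
  pose (e := fun x => epsilon model_inhabited
                        (fun a => Ord a /\ enum (fun _ => True) a = x)).
  assert (He : forall x, Ord (e x) /\ enum (fun _ => True) (e x) = x).
  { intros x; apply (epsilon_spec model_inhabited
      (fun a => Ord a /\ enum (fun _ => True) a = x)); now apply enum_onto. }
  exists e; split; [apply He |].
  intros x y H; rewrite <- (proj2 (He x)), <- (proj2 (He y)); congruence.
Qed.

(** The enumeration of [x] stops at the first [a] at which all the elements of [x]
    have been listed. *)
Lemma bij_Ord x : exists a, Ord a /\ bij x a.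
Proof.
  pose (X := fun y => y ∈ x).
  destruct (Ord_bound (fun y => epsilon model_inhabited
    (fun a => Ord a /\ enum X a = y)) x) as (b & Hb & Hxb).
  destruct (wf_minimal (fun a => Ord a /\ forall y, ~ fresh X (enum X) a y) b)
    as (a & [Ha Hfull] & Hmin).
  { split; [exact Hb |]; intros y [Hy Hn].
    destruct (epsilon_spec model_inhabited (fun a => Ord a /\ enum X a = y))
      as [H1 H2]; [now apply enum_onto |].
    apply (Hn _ (Hxb y Hy H1)); auto. }
  assert (Hn : forall c, c ∈ a -> next X (enum X) c (enum X c)).
  { intros c Hc; destruct (classic (exists y, fresh X (enum X) c y)) as [[y Hy] | H].
    - eapply enum_next; eauto.
    - destruct (Hmin c Hc); split; [eauto using Ord_in |]; eauto. }
  pose (G := fun y => epsilon model_inhabited (fun c => c ∈ a /\ enum X c = y)).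
  assert (HG : forall y, y ∈ x -> G y ∈ a /\ enum X (G y) = y).
  { intros y Hy; apply (epsilon_spec model_inhabited (fun c => c ∈ a /\ enum X c = y)).
    apply NNPP; intros H; apply (Hfull y); split; [exact Hy |].
    intros c Hc ->; eauto. }
  exists a; split; [exact Ha |]; apply bij_sym; exists (enum X), G; split; [| exact HG].
  intros c Hc; assert (Hcx : enum X c ∈ x) by (destruct (Hn c Hc) as [[H _] _]; exact H).
  split; [exact Hcx |]; destruct (HG _ Hcx) as [Hg Eg].
  destruct (Ord_total (G (enum X c)) c) as [H | [H | H]]; eauto using Ord_in.
  - destruct (Hn c Hc) as [[_ H'] _]; destruct (H' _ H); auto.
  - destruct (Hn _ Hg) as [[_ H'] _]; destruct (H' _ H); auto.
Qed.

Lemma bij_cardinal x : exists m, sat E (cardinal m) /\ bij x m.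
Proof.
  destruct (bij_Ord x) as (a & Ha & Hxa).
  destruct (wf_minimal (fun a => Ord a /\ bij x a) a) as (m & [Hm Hxm] & Hmin); [auto |].
  exists m; split; [| exact Hxm]; split; [exact Hm |].
  intros b Hb Hbm; apply (proj1 (sat_equipotent b m)) in Hbm; apply (Hmin b Hb); split.
  - eauto using Ord_in.
  - eauto using bij_trans, bij_sym.
Qed.

(** * Coded formulas and the satisfaction relation *)

(** The set coding a formula whose outermost symbol has number [n]. *)
Definition coded n x y := opair (num n) (opair x y).

Lemma sat_numeral n : forall x, sat E (numeral n x) <-> x = num n.
Proof.
  induction n as [|n IH]; intros x; split.
  - intros H; apply ext; intros z; split; intros Hz; [destruct (H z Hz) |].
    now apply empE in Hz.
  - intros -> z; apply empE.
  - intros (y & Hy & H); apply IH in Hy as ->.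
    apply ext; intros u; cbn [num]; rewrite succE; apply H.
  - intros ->; exists (num n); split; [now apply IH |]; intros u; apply succE.
Qed.

Lemma sat_code n x y c : sat E (code n x y c) <-> c = coded n x y.
Proof.
  split.
  - intros (k & q & Hk & Hq & Hc).
    apply sat_numeral in Hk as ->; apply sat_pair in Hq as ->; now apply sat_pair in Hc.
  - intros ->; exists (num n), (opair x y); split; [now apply sat_numeral |].
    split; now apply sat_pair.
Qed.

Lemma coded_inj n x y n' x' y' : coded n x y = coded n' x' y' -> n = n' /\ x = x' /\ y = y'.
Proof.
  intros H; apply opair_inj in H as [H1 H2]; apply num_inj in H1; apply opair_inj in H2.
  tauto.
Qed.

Lemma rank_coded_l n x y : rank x ∈ rank (coded n x y).
Proof. eapply rank_trans; [apply (rank_in_opair_l x y) | apply rank_in_opair_r]. Qed.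

Lemma rank_coded_r n x y : rank y ∈ rank (coded n x y).
Proof. eapply rank_trans; [apply (rank_in_opair_r x y) | apply rank_in_opair_r]. Qed.

Definition closed_under_codes (X : U -> Prop) :=
  (forall i j, i ∈ omega -> j ∈ omega ->
    X (coded 0 i j) /\ X (coded 1 i j) /\ X (coded 2 i i)) /\
  (forall p, X p -> X (coded 3 p p)) /\
  (forall p q, X p -> X q -> X (coded 4 p q)) /\
  (forall i p, i ∈ omega -> X p -> X (coded 5 i p)).

Lemma sat_formula_closed X :
  sat E (formula_closed omega X) <-> closed_under_codes (fun x => x ∈ X).
Proof.
  split.
  - intros (H1 & H2 & H3 & H4); split; [| split; [| split]].
    + intros i j Hi Hj; split; [| split]; apply (H1 i Hi j Hj);
        [left | right; left | right; right]; now apply sat_code.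
    + intros p Hp; apply (H2 p Hp); now apply sat_code.
    + intros p q Hp Hq; apply (H3 p Hp q Hq); now apply sat_code.
    + intros i p Hi Hp; apply (H4 i Hi p Hp); now apply sat_code.
  - intros (H1 & H2 & H3 & H4); split; [| split; [| split]].
    + intros i Hi j Hj c [H | [H | H]]; apply (sat_code _ _ _ c) in H as ->;
        destruct (H1 i j Hi Hj) as (? & ? & ?); assumption.
    + intros p Hp c H; apply sat_code in H as ->; now apply H2.
    + intros p Hp q Hq c H; apply sat_code in H as ->; now apply H3.
    + intros i Hi p Hp c H; apply sat_code in H as ->; now apply H4.
Qed.

Lemma rank_num_omega i : i ∈ omega -> rank i ∈ omega.
Proof.
  intros Hi; rewrite rank_Ord; [exact Hi |].
  exact (Ord_in omega i (Lim_Ord _ Lim_omega) Hi).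
Qed.

Lemma rank_coded n x y : rank x ∈ omega -> rank y ∈ omega -> rank (coded n x y) ∈ omega.
Proof.
  intros Hx Hy; pose proof Lim_omega.
  apply rank_opair; [assumption | | now apply rank_opair].
  apply rank_num_omega, omegaE; eauto.
Qed.

Lemma finite_rank_closed : closed_under_codes (fun x => x ∈ Vs omega).
Proof.
  pose proof (VsE omega (Lim_Ord _ Lim_omega)) as H.
  repeat split; intros; apply H; apply rank_coded; try (now apply H); now apply rank_num_omega.
Qed.

Definition formulas :=
  set_of (fun x => forall X, closed_under_codes (fun y => y ∈ X) -> x ∈ X).

Lemma formulasE x :
  x ∈ formulas <-> forall X, closed_under_codes (fun y => y ∈ X) -> x ∈ X.
Proof.
  revert x; apply (set_ofE (fun x => forall X, closed_under_codes (fun y => y ∈ X) -> x ∈ X)).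
  apply (small_sub_rank _ omega (Lim_Ord _ Lim_omega)).
  intros x Hx; apply (VsE omega (Lim_Ord _ Lim_omega)), Hx, finite_rank_closed.
Qed.

Lemma formulas_closed : closed_under_codes (fun x => x ∈ formulas).
Proof.
  split; [| split; [| split]].
  - intros i j Hi Hj; rewrite !formulasE.
    split; [| split]; intros X (H & _); now apply (H i j).
  - intros p Hp; apply formulasE; intros X HX; apply HX; now apply formulasE.
  - intros p q Hp Hq; apply formulasE; intros X HX; apply HX; now apply formulasE.
  - intros i p Hi Hp; apply formulasE; intros X HX; apply HX; [exact Hi | now apply formulasE].
Qed.

Lemma sat_is_formulas : sat E (is_formulas omega formulas).
Proof.
  split; [apply sat_formula_closed, formulas_closed |].
  intros X HX p Hp; apply (proj1 (sat_formula_closed X)) in HX.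
  now apply formulasE.
Qed.

Lemma rank_formula p : p ∈ formulas -> rank p ∈ omega.
Proof.
  intros Hp; apply (VsE omega (Lim_Ord _ Lim_omega)).
  apply (proj1 (formulasE p) Hp), finite_rank_closed.
Qed.

Definition prod a b := union_of (fun x => image (opair x) b) a.

Lemma prodE a b x y : opair x y ∈ prod a b <-> x ∈ a /\ y ∈ b.
Proof.
  unfold prod; rewrite union_ofE; split.
  - intros (x' & Hx & H); apply imageE in H as (y' & Hy & H).
    apply opair_inj in H as [-> ->]; auto.
  - intros [Hx Hy]; exists x; split; [exact Hx |]; now apply in_image.
Qed.

Section Structure.
Variables A r P : U.

(** One step of the definition of truth; the recursion is on the rank of the code,
    as the codes of subformulas have smaller rank. *)
Definition tarski (T : U -> U -> Prop) (c s : U) : Prop :=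
  (exists i j, c = coded 0 i j /\
     exists x y, sat E (rel s i x) /\ sat E (rel s j y) /\ sat E (rel r x y)) \/
  (exists i j, c = coded 1 i j /\ exists x, sat E (rel s i x) /\ sat E (rel s j x)) \/
  (exists i, c = coded 2 i i /\ exists x, sat E (rel s i x) /\ x ∈ P) \/
  (exists p, c = coded 3 p p /\ ~ T p s) \/
  (exists p q, c = coded 4 p q /\ T p s /\ T q s) \/
  (exists i p, c = coded 5 i p /\ exists a, a ∈ A /\ exists s',
     sat E (fun_to s' omega A) /\ sat E (updates omega s i a s') /\ T p s').

Lemma tarski_ext T T' c s : (forall p, rank p ∈ rank c -> T p = T' p) ->
  tarski T c s -> tarski T' c s.
Proof.
  intros H [h | [h | [h | [h | [h | h]]]]]; unfold tarski.
  - auto.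
  - auto.
  - auto.
  - do 3 right; left; destruct h as (p & -> & h); exists p.
    rewrite <- H; auto using rank_coded_l.
  - do 4 right; left; destruct h as (p & q & -> & h); exists p, q.
    rewrite <- !H; auto using rank_coded_l, rank_coded_r.
  - do 5 right; destruct h as (i & p & -> & h); exists i, p.
    rewrite <- H; auto using rank_coded_r.
Qed.

Lemma truth_exists : exists T, forall c, T c = tarski T c.
Proof.
  apply (wf_recursion (fun y x => rank y ∈ rank x)
           (wf_inverse_image _ _ _ rank (model_wf E M)) (fun _ => True) (fun c T => tarski T c)).
  intros c T T' H; apply functional_extensionality; intros s.
  apply propositional_extensionality; split; apply tarski_ext; auto.
  intros p Hp; symmetry; auto.
Qed.

Definition truth := proj1_sig (constructive_indefinite_description _ truth_exists).

Lemma truthE c s : truth c s <-> tarski truth c s.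
Proof.
  unfold truth; destruct constructive_indefinite_description as [T HT]; cbn.
  rewrite <- HT; reflexivity.
Qed.

Definition satisfaction := set_of (fun z => exists c s, z = opair c s /\
  c ∈ formulas /\ sat E (fun_to s omega A) /\ truth c s).

Lemma satisfactionE z : z ∈ satisfaction <-> exists c s, z = opair c s /\
  c ∈ formulas /\ sat E (fun_to s omega A) /\ truth c s.
Proof.
  revert z; apply (set_ofE (fun z => exists c s, z = opair c s /\
    c ∈ formulas /\ sat E (fun_to s omega A) /\ truth c s)).
  apply (small_sep _ (prod formulas (pow (prod omega A)))).
  intros z (c & s & -> & Hc & Hs & _); apply prodE; split; [exact Hc |].
  apply fun_to_elim in Hs as (F & HF & ->).
  apply powE; intros p Hp; apply imageE in Hp as (n & Hn & ->); apply prodE; auto.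
Qed.

(** Reads a truth clause off [tarski]: codes with distinct numbers are distinct, so
    all disjuncts but one are absurd. *)
Ltac by_code :=
  intros H; apply truthE in H; unfold tarski in H;
  repeat match type of H with _ \/ _ => destruct H as [H | H] end;
  repeat match type of H with
    | _ = _ /\ _ => fail 1 | exists _, _ => destruct H as [? H] end;
  let e := fresh in destruct H as [e H]; apply coded_inj in e as (e & ? & ?);
  try discriminate e; subst; exact H.

Lemma truth_mem i j s : truth (coded 0 i j) s <->
  exists x y, sat E (rel s i x) /\ sat E (rel s j y) /\ sat E (rel r x y).
Proof.
  split; [by_code |]; intros H; apply truthE; left; exists i, j; auto.
Qed.

Lemma truth_eq i j s : truth (coded 1 i j) s <->
  exists x, sat E (rel s i x) /\ sat E (rel s j x).
Proof.
  split; [by_code |]; intros H; apply truthE; right; left; exists i, j; auto.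
Qed.

Lemma truth_pred i s : truth (coded 2 i i) s <-> exists x, sat E (rel s i x) /\ x ∈ P.
Proof.
  split; [by_code |]; intros H; apply truthE; do 2 right; left; exists i; auto.
Qed.

Lemma truth_not p s : truth (coded 3 p p) s <-> ~ truth p s.
Proof.
  split; [by_code |]; intros H; apply truthE; do 3 right; left; exists p; auto.
Qed.

Lemma truth_and p q s : truth (coded 4 p q) s <-> truth p s /\ truth q s.
Proof.
  split; [by_code |]; intros H; apply truthE; do 4 right; left; exists p, q; auto.
Qed.

Lemma truth_ex i p s : truth (coded 5 i p) s <-> exists a, a ∈ A /\ exists s',
  sat E (fun_to s' omega A) /\ sat E (updates omega s i a s') /\ truth p s'.
Proof.
  split; [by_code |]; intros H; apply truthE; do 5 right; exists i, p; auto.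
Qed.

Lemma satisfaction_truth c s : c ∈ formulas -> sat E (fun_to s omega A) ->
  sat E (rel satisfaction c s) <-> truth c s.
Proof.
  intros Hc Hs; rewrite sat_rel, satisfactionE; split.
  - intros (c' & s' & H & _ & _ & Ht); now apply opair_inj in H as [-> ->].
  - intros Ht; exists c, s; auto.
Qed.

Lemma sat_is_satisfaction : sat E (is_satisfaction omega formulas A r P satisfaction).
Proof.
  destruct formulas_closed as (L1 & L2 & L3 & L4).
  intros s Hs; split; [| split; [| split]].
  - intros i Hi j Hj c; destruct (L1 i j Hi Hj) as (C0 & C1 & C2).
    split; [| split]; intros Hc; apply (proj1 (sat_code _ _ _ _)) in Hc as ->.
    + exact (iff_trans (satisfaction_truth _ s C0 Hs) (truth_mem i j s)).
    + exact (iff_trans (satisfaction_truth _ s C1 Hs) (truth_eq i j s)).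
    + exact (iff_trans (satisfaction_truth _ s C2 Hs) (truth_pred i s)).
  - intros p Hp c Hc; apply (proj1 (sat_code _ _ _ _)) in Hc as ->.
    apply (iff_trans (satisfaction_truth _ s (L2 p Hp) Hs)).
    apply (iff_trans (truth_not p s)).
    apply not_iff_compat, iff_sym, satisfaction_truth; auto.
  - intros p Hp q Hq c Hc; apply (proj1 (sat_code _ _ _ _)) in Hc as ->.
    apply (iff_trans (satisfaction_truth _ s (L3 p q Hp Hq) Hs)).
    apply (iff_trans (truth_and p q s)), iff_sym.
    split; intros [H1 H2]; split; first [exact (proj1 (satisfaction_truth _ s Hp Hs) H1)
      | exact (proj1 (satisfaction_truth _ s Hq Hs) H2)
      | now apply satisfaction_truth].
  - intros i Hi p Hp c Hc; apply (proj1 (sat_code _ _ _ _)) in Hc as ->.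
    apply (iff_trans (satisfaction_truth _ s (L4 i p Hi Hp) Hs)).
    apply (iff_trans (truth_ex i p s)).
    split; intros (a & Ha & s' & Hs' & Hu & Ht); exists a; (split; [exact Ha |]);
      exists s'; (split; [exact Hs' | split; [exact Hu |]]); now apply satisfaction_truth.
Qed.

End Structure.

(** * Closure points *)

(** The union of an [omega]-sequence starting above [a], each term of which bounds
    the values of [h] on the previous one. *)
Lemma closure_unbounded (h : U -> U) a : (forall x, Ord (h x)) -> Ord a ->
  exists k, Lim k /\ a ∈ k /\ forall x, x ∈ k -> h x ∈ k.
Proof.
  intros Hh Ha.
  assert (Hstep : forall c, exists d, Ord c -> Ord d /\ c ∈ d /\ forall x, x ∈ c -> h x ∈ d).
  { intros c; destruct (Ord_bound h c) as (b & Hb & Hc).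
    exists (union_of succ (pair b c)); intros Ho; split; [| split].
    - apply Ord_union_of; intros x Hx; apply pairE in Hx as [-> | ->]; now apply Ord_succ.
    - apply union_ofE; exists c; split; [apply pairE | apply succE]; auto.
    - intros x Hx; apply union_ofE; exists b; split; [apply pairE | apply succE]; auto. }
  apply choice in Hstep as [f Hf].
  pose (it := fix it n := match n with O => succ a | S n => f (it n) end).
  assert (Hit : forall n, Ord (it n)).
  { induction n as [|n IH]; [now apply Ord_succ |]; now apply (Hf (it n)). }
  exists (union_of (fun x => x) (set_of (fun y => exists n, y = it n))).
  assert (Hk : forall x, x ∈ union_of (fun x => x) (set_of (fun y => exists n, y = it n)) <->
    exists n, x ∈ it n).
  { intros x; rewrite union_ofE; split.
    - intros (y & Hy & Hx); apply (set_ofE _ (small_seq it)) in Hy as [n ->]; eauto.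
    - intros [n Hn]; exists (it n); split; [apply (set_ofE _ (small_seq it)) |]; eauto. }
  split; [| split].
  - apply (Lim_intro _ a).
    + apply Ord_union_of; intros y Hy.
      apply (set_ofE _ (small_seq it)) in Hy as [n ->]; apply Hit.
    + apply Hk; exists 0; apply succE; auto.
    + intros y Hy; apply Hk in Hy as [n Hn]; exists (it n); split; [| exact Hn].
      apply Hk; exists (S n); now apply (Hf (it n)).
  - apply Hk; exists 0; apply succE; auto.
  - intros x Hx; apply Hk in Hx as [n Hn]; apply Hk; exists (S n); now apply (Hf (it n)).
Qed.

(** Subtlety of the class of all ordinals.  The sequence [S] and the club [C] range
    over all predicates of the metatheory; the set attached to [a] is that of the
    [x] in [a] with [S a x]. *)
Definition ord_subtle := forall (S : U -> U -> Prop) (C : U -> Prop),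
  (forall a, C a -> Ord a) ->
  (forall a, Ord a -> exists b, C b /\ a ∈ b) ->
  (forall d, Lim d -> (forall a, a ∈ d -> exists b, C b /\ b ∈ d /\ a ∈ b) -> C d) ->
  exists b g, C b /\ C g /\ b ∈ g /\ forall x, x ∈ b -> (S b x <-> S g x).

(** Subtlety for sequences of subsets of the levels of the hierarchy.  If [e] is the
    injection given by the global well-ordering, then [e] maps [Vs b] into [b] for
    all [b] in a club, so that [T b] is coded by its image under [e]; the closure
    points of [h] form another club. *)
Lemma subtle_hierarchy (T : U -> U -> Prop) (h : U -> U) :
  ord_subtle -> (forall x, Ord (h x)) ->
  exists b g, b ∈ g /\ (forall x, x ∈ Vs b -> (T b x <-> T g x)) /\
    (Lim b /\ omega ∈ b /\ forall x, x ∈ b -> h x ∈ b) /\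
    (Lim g /\ omega ∈ g /\ forall x, x ∈ g -> h x ∈ g).
Proof.
  intros Hsub Hh.
  destruct global_well_order as (e & He & Hinj).
  assert (Hb : forall c, exists d, Ord d /\ forall x, x ∈ Vs c -> e x ∈ d).
  { intros c; destruct (Ord_bound e (Vs c)) as (d & Hd & Hx); eauto. }
  apply choice in Hb as [k Hk].
  set (C := fun c => Lim c /\ omega ∈ c /\ forall x, x ∈ c -> h x ∈ c /\ k x ∈ c).
  destruct (Hsub (fun c y => exists x, y = e x /\ T c x) C) as (b & g & Hb & Hg & Hbg & Heq).
  - intros a (Ha & _); now apply Lim_Ord.
  - intros a Ha.
    destruct (closure_unbounded (fun x => union_of (fun y => succ y) (pair (h x) (k x)))
      (union_of (fun y => succ y) (pair a omega))) as (c & Hc & Hac & Hcc).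
    + intros x; apply Ord_union_of; intros y Hy; apply pairE in Hy as [-> | ->];
        apply Ord_succ; [apply Hh | apply Hk].
    + apply Ord_union_of; intros y Hy; apply pairE in Hy as [-> | ->];
        apply Ord_succ; [exact Ha | apply Lim_Ord, Lim_omega].
    + pose proof (Lim_Ord c Hc) as Ho.
      assert (Hin : forall u v, union_of (fun y => succ y) (pair u v) ∈ c -> u ∈ c /\ v ∈ c).
      { intros u v Huv; split; apply (Ord_trans c Ho _ _ Huv), union_ofE;
          [exists u | exists v]; split; solve [apply pairE; auto | apply succE; auto]. }
      apply Hin in Hac as [Hac Hoc].
      exists c; split; [| exact Hac]; split; [exact Hc | split; [exact Hoc |]].
      intros x Hx; now apply Hin, Hcc.
  - intros d Hd H; split; [exact Hd | split].
    + destruct (H emp (Lim_emp d Hd)) as (b & (_ & Hb & _) & Hbd & _).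
      eapply Ord_trans; [now apply Lim_Ord | exact Hbd | exact Hb].
    + intros x Hx; destruct (H x Hx) as (b & (_ & _ & Hb) & Hbd & Hxb).
      destruct (Hb x Hxb); split; (eapply Ord_trans; [now apply Lim_Ord | exact Hbd |]);
        assumption.
  - destruct Hb as (Lb & Ob & Cb), Hg as (Lg & Og & Cg).
    exists b, g; split; [exact Hbg | split; [| split]].
    + intros x Hx.
      assert (Heb : e x ∈ b).
      { apply VsE in Hx; [| now apply Lim_Ord].
        destruct (Lim_next b _ Lb Hx) as (c & Hc & Hxc).
        apply (Ord_trans b (Lim_Ord b Lb) (k c)); [now apply Cb |].
        apply Hk, VsE; [exact (Ord_in b c (Lim_Ord b Lb) Hc) | exact Hxc]. }
      destruct (Heq (e x) Heb) as [H1 H2]; split; intros HT.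
      * destruct H1 as (y & Hy & HTy); [eauto |]; now apply Hinj in Hy as ->.
      * destruct H2 as (y & Hy & HTy); [eauto |]; now apply Hinj in Hy as ->.
    + split; [exact Lb | split; [exact Ob | intros x Hx; now apply Cb]].
    + split; [exact Lg | split; [exact Og | intros x Hx; now apply Cg]].
Qed.

(** * End elementary extensions between levels of the hierarchy *)

(** A regular limit ordinal is a cardinal, since a bijection from a smaller ordinal
    would be unbounded. *)
Lemma inaccessible_intro k : Lim k -> omega ∈ k -> sat E (regular k) ->
  (forall l, l ∈ k -> exists m, m ∈ k /\ sat E (cardinal m) /\ bij (pow l) m) ->
  sat E (inaccessible k).
Proof.
  intros Lk Ok Rk Pk; split; [| split; [| split]].
  - split; [now apply Lim_Ord |].
    intros a Ha H; apply (proj1 (sat_equipotent a k)) in H as (F & G & HF & HG).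
    destruct (proj1 (sat_regular k) Rk a F Ha) as (b & Hb & Hlt).
    + intros x Hx; now apply HF.
    + destruct (HG b Hb) as [HGa HGb]; apply (mem_irrefl b).
      rewrite <- HGb at 1; now apply Hlt.
  - exists omega; split; [exact Ok | apply sat_is_omega].
  - exact Rk.
  - intros l Hl _; destruct (Pk l Hl) as (m & Hm & Cm & Bm).
    exists (pow l), m; split; [exact Hm | split; [| split]].
    + now apply sat_power.
    + exact Cm.
    + now apply sat_equipotent.
Qed.

Definition membership A :=
  set_of (fun p => exists x y, p = opair x y /\ x ∈ A /\ y ∈ A /\ x ∈ y).

Lemma membershipE A p :
  p ∈ membership A <-> exists x y, p = opair x y /\ x ∈ A /\ y ∈ A /\ x ∈ y.
Proof.
  revert p; apply (set_ofE (fun p => exists x y, p = opair x y /\ x ∈ A /\ y ∈ A /\ x ∈ y)).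
  apply (small_sep _ (prod A A)).
  intros p (x & y & -> & Hx & Hy & _); now apply prodE.
Qed.

Lemma sat_rel_membership A x y :
  sat E (rel (membership A) x y) <-> x ∈ A /\ y ∈ A /\ x ∈ y.
Proof.
  rewrite sat_rel, membershipE; split.
  - intros (x' & y' & H & Hx); now apply opair_inj in H as [-> ->].
  - intros H; exists x, y; auto.
Qed.

Lemma sat_is_membership A : sat E (is_membership A (membership A)).
Proof.
  intros p; apply (iff_trans (membershipE A p)); split.
  - intros (x & y & -> & Hx & Hy & H).
    exists x; split; [exact Hx |]; exists y; split; [exact Hy |].
    split; [exact H | now apply sat_pair].
  - intros (x & Hx & y & Hy & H & Hp); apply sat_pair in Hp as ->; exists x, y; auto.
Qed.

(** The matrix of [unfoldable] at the level [Vs k]. *)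
Definition has_extension k a S := exists B F Q,
  sat E (is_structure B F Q) /\ sat E (eee (Vs k) (membership (Vs k)) S B F Q) /\
  sat E (well_founded_rel B F) /\ exists o, sat E (is_height B F o) /\ sat E (subset a o).

Lemma unfoldable_intro k : sat E (inaccessible k) ->
  (forall a S, Ord a -> sat E (subset S (Vs k)) -> has_extension k a S) ->
  sat E (unfoldable k).
Proof.
  intros Hk H; assert (Ok : Ord k) by (destruct Hk as ((Ok & _) & _); exact Ok).
  split; [exact Hk |]; exists (Vs k), (membership (Vs k)).
  split; [| split; [apply sat_is_membership |]].
  - intros x; apply (iff_trans (VsE k Ok x)), iff_sym, sat_rank_lt.
  - intros a S [Ha HS]; exact (H a S Ha HS).
Qed.

Definition diagram k S := satisfaction (Vs k) (membership (Vs k)) S.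

(** This is where regularity enters: below a regular [b > omega], assignments of
    variables in [Vs b] are themselves elements of [Vs b]. *)
Lemma rank_assignment b s : Lim b -> omega ∈ b -> sat E (regular b) ->
  sat E (fun_to s omega (Vs b)) -> rank s ∈ b.
Proof.
  intros Lb Ob Rb Hs; pose proof (Lim_Ord b Lb) as Hob.
  apply fun_to_elim in Hs as (F & HF & ->).
  destruct (proj1 (sat_regular b) Rb omega (fun n => rank (opair n (F n))) Ob)
    as (c & Hc & Hlt).
  - intros n Hn; apply rank_opair; [exact Lb | |].
    + apply (Ord_trans b Hob omega _ Ob); exact (rank_num_omega n Hn).
    + apply VsE; [exact Hob |]; now apply HF.
  - apply (rank_bound _ c b Hob Hc); intros p Hp; apply imageE in Hp as (n & Hn & ->).
    now apply Hlt.
Qed.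

(** The extension is [Vs g] itself.  The only pairs in question are those of a
    formula and an assignment in [Vs b], all of which lie in [Vs b], so elementarity
    is the coherence of the two diagrams.  As [Vs g] is transitive, it is its own
    transitive collapse and has height [g]. *)
Lemma coherent_extension b g a S S' : Lim b -> omega ∈ b -> sat E (regular b) ->
  Lim g -> b ∈ g -> a ∈ g -> sat E (subset S' (Vs g)) ->
  (forall p s, opair p s ∈ Vs b -> (opair p s ∈ diagram b S <-> opair p s ∈ diagram g S')) ->
  has_extension b a S.
Proof.
  intros Lb Ob Rb Lg Hbg Hag HS' Heq.
  pose proof (Lim_Ord b Lb) as Hob; pose proof (Lim_Ord g Lg) as Hog.
  exists (Vs g), (membership (Vs g)), S'; split; [| split; [| split]].
  - split; [| exact HS'].
    intros p Hp; apply membershipE in Hp as (x & y & -> & Hx & Hy & _).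
    exists x; split; [exact Hx |]; exists y; split; [exact Hy | now apply sat_pair].
  - assert (Hsub : forall x, x ∈ Vs b -> x ∈ Vs g).
    { intros x Hx; apply VsE in Hx; [| exact Hob]; apply VsE; [exact Hog |].
      eauto using Ord_trans. }
    split; [| split].
    + split; [exact Hsub |].
      exists omega, formulas, (diagram b S), (diagram g S').
      split; [apply sat_is_omega | split; [apply sat_is_formulas |]].
      split; [apply sat_is_satisfaction | split; [apply sat_is_satisfaction |]].
      intros p Hp s Hs; apply (iff_trans (sat_rel _ p s)).
      apply (fun H => iff_trans H (iff_sym (sat_rel _ p s))), Heq.
      apply VsE; [exact Hob |]; apply rank_opair; [exact Lb | |].
      * apply (Ord_trans b Hob omega _ Ob), rank_formula, Hp.
      * now apply rank_assignment.
    + exists b; split.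
      * apply VsE; [exact Hog |]; now rewrite rank_Ord.
      * intros H; apply VsE in H; [| exact Hob]; rewrite rank_Ord in H; [| exact Hob].
        now apply mem_irrefl in H.
    + intros x Hx y; split; intros [Hy H]; apply sat_rel_membership in H as (_ & _ & H).
      * split; [now apply Hsub |]; apply sat_rel_membership; auto.
      * assert (y ∈ Vs b) by exact (Vs_trans b x y Hob Hx H).
        split; [assumption |]; apply sat_rel_membership; auto.
  - intros X [_ HX].
    destruct (classic (exists x, x ∈ X)) as [[x Hx] | Hn].
    + destruct (wf_minimal (fun x => x ∈ X) x Hx) as (m & Hm & Hmin).
      exists m; split; [exact Hm |]; intros y Hy H.
      apply sat_rel_membership in H as (_ & _ & H); exact (Hmin y H Hy).
    + destruct HX; intros x Hx; apply Hn; eauto.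
  - exists g; split.
    + exists (graph (fun x => x) (Vs g)); split; [split; [apply fun_on_graph |] |].
      * intros x Hx v Hv; apply sat_rel_graph in Hv as [_ ->]; intros u; split.
        -- intros Hu; assert (Hug : u ∈ Vs g) by exact (Vs_trans g x u Hog Hx Hu).
           exists u; split; [exact Hug |].
           split; [now apply sat_rel_membership | now apply sat_rel_graph].
        -- intros (y & Hy & H & Hr); apply sat_rel_graph in Hr as [_ ->].
           now apply sat_rel_membership in H as (_ & _ & H).
      * intros d; split.
        -- intros Hd; assert (Hod : Ord d) by exact (Ord_in g d Hog Hd).
           split; [exact Hod |].
           assert (Hdg : d ∈ Vs g) by (apply VsE; [exact Hog | now rewrite rank_Ord]).
           exists d; split; [exact Hdg | now apply sat_rel_graph].
        -- intros [Hod (x & Hx & Hr)]; apply sat_rel_graph in Hr as [_ ->].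
           apply VsE in Hx; [| exact Hog]; now rewrite rank_Ord in Hx.
    + intros x Hx; exact (Ord_trans g Hog a x Hag Hx).
Qed.

(** * An unfoldable cardinal *)

Theorem unfoldable_exists : ord_subtle -> exists k, Ord k /\ sat E (unfoldable k).
Proof.
  intros Hsub; apply NNPP; intros Hno.
  assert (Hbad : forall k, exists q, Ord (fst q) /\ (sat E (inaccessible k) ->
    sat E (subset (snd q) (Vs k)) /\ ~ has_extension k (fst q) (snd q))).
  { intros k; destruct (classic (exists a S, Ord a /\ sat E (subset S (Vs k)) /\
      ~ has_extension k a S)) as [(a & S & Ha & HS & H) | H].
    - exists (a, S); auto.
    - exists (emp, emp); split; [apply Ord_emp |]; intros Hk; destruct Hno.
      exists k; split; [destruct Hk as ((Ok & _) & _); exact Ok |].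
      apply unfoldable_intro; [exact Hk |].
      intros a S Ha HS; apply NNPP; intros Hn; apply H; eauto. }
  apply choice in Hbad as [q Hq].
  assert (Hsing : forall k, exists w : U * (U -> U), ~ sat E (regular k) ->
    fst w ∈ k /\ (forall x, x ∈ fst w -> snd w x ∈ k) /\
    forall b, b ∈ k -> ~ forall x, x ∈ fst w -> snd w x ∈ b).
  { intros k; apply NNPP; intros H.
    assert (Hk : sat E (regular k)).
    { apply sat_regular; intros a F Ha HF; apply NNPP; intros Hn; apply H.
      exists (a, F); intros _; split; [exact Ha | split; [exact HF |]].
      intros b Hb Hlt; apply Hn; eauto. }
    apply H; exists (emp, fun x => x); tauto. }
  apply choice in Hsing as [w Hw].
  destruct (choice _ (fun l => bij_cardinal (pow l))) as [c Hc].
  (* The data attached to [k].  The set [emp] is not a pair, so it belongs to [T k]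
     exactly when [k] is regular.  In the singular case each element of [T k]
     records the whole domain of the witness, together with one of its values. *)
  set (T := fun k x =>
    sat E (regular k) /\ (x = emp \/ x ∈ diagram k (snd (q k))) \/
    ~ sat E (regular k) /\
      exists y, y ∈ fst (w k) /\ x = opair (fst (w k)) (opair y (snd (w k) y))).
  destruct (subtle_hierarchy T (fun x => union_of succ (pair (fst (q x)) (c x))))
    as (b & g & Hbg & HT & (Lb & Ob & Cb) & (Lg & Og & Cg)); [exact Hsub | |].
  { intros x; apply Ord_union_of; intros y Hy; apply pairE in Hy as [-> | ->]; apply Ord_succ.
    - apply Hq.
    - destruct (Hc x) as [[Hx _] _]; exact Hx. }
  assert (Hin : forall k x, Lim k -> union_of succ (pair (fst (q x)) (c x)) ∈ k ->
    fst (q x) ∈ k /\ c x ∈ k).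
  { intros k x Lk H; split; apply (Ord_trans k (Lim_Ord k Lk) _ _ H), union_ofE;
      [exists (fst (q x)) | exists (c x)]; split; solve [apply pairE; auto | apply succE; auto]. }
  assert (Hinacc : forall k, Lim k -> omega ∈ k ->
    (forall x, x ∈ k -> union_of succ (pair (fst (q x)) (c x)) ∈ k) ->
    sat E (regular k) -> sat E (inaccessible k)).
  { intros k Lk Ok Ck Rk; apply inaccessible_intro; auto.
    intros l Hl; exists (c l); split; [now apply (Hin k l), Ck | apply Hc]. }
  pose proof (Lim_Ord b Lb) as Hob; pose proof (Lim_Ord g Lg) as Hog.
  assert (Hreg : sat E (regular b) <-> sat E (regular g)).
  { assert (Hk : forall k, T k emp <-> sat E (regular k)).
    { intros k; split; [| left; auto].
      intros [[H _] | (_ & y & _ & H)]; [exact H |].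
      symmetry in H; now apply opair_not_emp in H. }
    rewrite <- !Hk; apply HT, VsE; [exact Hob |].
    rewrite rank_Ord; [now apply Lim_emp | apply Ord_emp]. }
  destruct (classic (sat E (regular b))) as [Rb | Rb].
  - assert (Rg : sat E (regular g)) by tauto.
    destruct (Hq b) as [_ [_ Hext]]; [now apply Hinacc |].
    destruct (Hq g) as [_ [HSg _]]; [now apply Hinacc |].
    apply Hext, (coherent_extension b g _ _ (snd (q g))); auto.
    + now apply (Hin g b), Cg.
    + intros p s Hps; destruct (HT _ Hps) as [H1 H2]; split; intros H.
      * destruct H1 as [[_ [H1 | H1]] | [H1 _]]; [left; auto | | exact H1 | contradiction].
        now apply opair_not_emp in H1.
      * destruct H2 as [[_ [H2 | H2]] | [H2 _]]; [left; auto | | exact H2 | contradiction].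
        now apply opair_not_emp in H2.
  - destruct (Hw b Rb) as (Hab & HFb & Hcof).
    assert (Hcode : forall y, y ∈ fst (w b) ->
      fst (w g) = fst (w b) /\ snd (w g) y = snd (w b) y).
    { intros y Hy.
      assert (HV : forall x, x ∈ b -> rank x ∈ b).
      { intros x Hx; rewrite rank_Ord; [exact Hx | exact (Ord_in b x Hob Hx)]. }
      assert (Hx : opair (fst (w b)) (opair y (snd (w b) y)) ∈ Vs b).
      { apply VsE; [exact Hob |]; repeat (apply rank_opair; [exact Lb | |]); apply HV; auto.
        exact (Ord_trans b Hob _ _ Hab Hy). }
      destruct (HT _ Hx) as [H _].
      destruct H as [[Rg _] | (_ & y' & _ & H)]; [right; eauto | tauto |].
      apply opair_inj in H as [H1 H]; apply opair_inj in H as [<- H]; auto. }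
    (* A map with empty domain is bounded by [emp]. *)
    assert (Hy : exists y, y ∈ fst (w b)).
    { apply NNPP; intros Hn; apply (Hcof emp (Lim_emp b Lb)).
      intros y Hy; destruct Hn; eauto. }
    destruct Hy as [y Hy]; destruct (Hcode y Hy) as [Hag _].
    destruct (Hw g) as (_ & _ & Hcof'); [tauto |]; apply (Hcof' b Hbg).
    intros x Hx; rewrite Hag in Hx; destruct (Hcode x Hx) as [_ ->]; auto.
Qed.

End Theory.

(** * Levels of the hierarchy as models *)

Section Level.
Context {U : Type} {E : U -> U -> Prop} (M : model E).
Variable k : U.
Hypothesis Hk : sat E (inaccessible k).

Local Notation "x ∈ y" := (E x y) (at level 70, no associativity).
Local Notation Ord x := (sat E (ordinal x)).
Local Notation Lim x := (sat E (limit x)).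
Local Notation rank := (rank M).
Local Notation bij := (bij (E := E)).

Lemma inaccessible_regular a F : a ∈ k -> (forall x, x ∈ a -> F x ∈ k) ->
  exists b, b ∈ k /\ forall x, x ∈ a -> F x ∈ b.
Proof. destruct Hk as (_ & _ & H & _); exact (proj1 (sat_regular M k) H a F). Qed.

Lemma inaccessible_omega : omega M ∈ k.
Proof.
  destruct Hk as ((Ok & _) & (w & Hw & Lw & _) & _).
  destruct (Ord_sub M (omega M) w) as [H | <-]; auto using Lim_Ord, Lim_omega.
  - intros x Hx; apply omegaE in Hx as [n ->].
    induction n as [|n IH]; [now apply Lim_emp | now apply Lim_succ].
  - exact (Ord_trans k Ok w _ Hw H).
Qed.

(** A constant map on [omega] with value [b] is bounded, so [b] is not the last
    element. *)
Lemma inaccessible_Lim : Lim k.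
Proof.
  destruct Hk as ((Ok & _) & _); apply (Lim_intro k _ Ok inaccessible_omega).
  intros b Hb.
  destruct (inaccessible_regular (omega M) (fun _ => b) inaccessible_omega) as (c & Hc & H);
    [auto |].
  exists c; split; [exact Hc | apply (H (emp M))]; apply omegaE; exists 0; auto.
Qed.

Let Lk := inaccessible_Lim.
Let Ok : Ord k := Lim_Ord k Lk.

Definition bounded_maps x := forall F, (forall y, y ∈ x -> F y ∈ k) ->
  exists b, b ∈ k /\ forall y, y ∈ x -> F y ∈ b.

Lemma bounded_maps_bij x m : bij x m -> m ∈ k -> bounded_maps x.
Proof.
  intros (F & G & HF & HG) Hm f Hf.
  destruct (inaccessible_regular m (fun y => f (G y)) Hm) as (b & Hb & H).
  - intros y Hy; apply Hf; now apply HG.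
  - exists b; split; [exact Hb |]; intros y Hy.
    destruct (HF y Hy) as [HFy <-]; now apply H.
Qed.

(** If the cardinality of [x] were at least [k], then [x] would map onto [k]. *)
Lemma bounded_maps_cardinal x : bounded_maps x ->
  exists m, m ∈ k /\ sat E (cardinal m) /\ bij x m.
Proof.
  intros Hx; destruct (bij_cardinal M x) as (m & Cm & Bm).
  exists m; split; [| auto].
  assert (Om : Ord m) by (destruct Cm as [Om _]; exact Om).
  assert (Hsub : ~ forall y, y ∈ k -> y ∈ m).
  { intros Hkm; destruct Bm as (F & G & HF & HG).
    destruct (Hx (fun y => if excluded_middle_informative (F y ∈ k) then F y else emp M))
      as (b & Hb & H).
    - intros y Hy; destruct excluded_middle_informative; [assumption | now apply Lim_emp].
    - destruct (HG b (Hkm b Hb)) as [HGb Eb]; specialize (H _ HGb); rewrite Eb in H.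
      destruct excluded_middle_informative; [now apply (mem_irrefl M b) | contradiction]. }
  destruct (Ord_total M m k Om Ok) as [H | [-> | H]]; [exact H | now destruct Hsub |].
  destruct Hsub; intros y Hy; exact (Ord_trans m Om k y H Hy).
Qed.

Lemma bij_pow x y : bij x y -> bij (pow M x) (pow M y).
Proof.
  intros (F & G & HF & HG); exists (image M F), (image M G); split.
  - intros u Hu; rewrite powE in Hu |- *; split.
    + intros z Hz; apply imageE in Hz as (t & Ht & ->); now apply HF, Hu.
    + apply (ext M); intros t; rewrite imageE; split.
      * intros (z & Hz & ->); apply imageE in Hz as (t & Ht & ->).
        now rewrite (proj2 (HF t (Hu t Ht))).
      * intros Ht; exists (F t); split; [now apply in_image |].
        symmetry; exact (proj2 (HF t (Hu t Ht))).
  - intros u Hu; rewrite powE in Hu |- *; split.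
    + intros z Hz; apply imageE in Hz as (t & Ht & ->); now apply HG, Hu.
    + apply (ext M); intros t; rewrite imageE; split.
      * intros (z & Hz & ->); apply imageE in Hz as (t & Ht & ->).
        now rewrite (proj2 (HG t (Hu t Ht))).
      * intros Ht; exists (G t); split; [now apply in_image |].
        symmetry; exact (proj2 (HG t (Hu t Ht))).
Qed.

(** The strong limit property only speaks about the power sets of cardinals, hence
    the detour through the cardinality of [x]. *)
Lemma bounded_maps_pow x : bounded_maps x -> bounded_maps (pow M x).
Proof.
  intros Hx; destruct (bounded_maps_cardinal x Hx) as (l & Hl & Cl & Bl).
  destruct Hk as (_ & _ & _ & H); destruct (H l Hl Cl) as (p & m & Hm & Hp & _ & Hpm).
  apply (proj1 (sat_power M l p)) in Hp as ->.
  apply (proj1 (sat_equipotent M _ _)) in Hpm.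
  apply (bounded_maps_bij _ m); [| exact Hm].
  apply (bij_trans _ (pow M l)); [now apply bij_pow | exact Hpm].
Qed.

(** [Vs a] is the union over [d] in [a] of the power sets of [Vs d].  The map is
    bounded on each of them, and by regularity the [a] many bounds have a common
    bound. *)
Lemma bounded_maps_Vs a : a ∈ k -> bounded_maps (Vs M a).
Proof.
  induction a as [a IH] using (well_founded_ind (model_wf E M)); intros Ha F HF.
  assert (Oa : Ord a) by exact (Ord_in M k a Ok Ha).
  assert (Hstep : forall d, exists b, d ∈ a ->
    b ∈ k /\ forall y, y ∈ pow M (Vs M d) -> F y ∈ b).
  { intros d; destruct (classic (d ∈ a)) as [Hd | Hd]; [| exists d; tauto].
    assert (Od : Ord d) by exact (Ord_in M a d Oa Hd).
    destruct (bounded_maps_pow _ (IH d Hd (Ord_trans k Ok a d Ha Hd)) F) as (b & Hb & H).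
    - intros y Hy; apply HF, VsE; [exact Oa |].
      apply (rank_bound M y d a Oa Hd); intros z Hz.
      rewrite powE in Hy; rewrite <- VsE; auto.
    - exists b; auto. }
  apply choice in Hstep as [f Hf].
  destruct (inaccessible_regular a f Ha) as (b & Hb & H); [intros d Hd; now apply Hf |].
  exists b; split; [exact Hb |]; intros y Hy; apply VsE in Hy; [| exact Oa].
  apply (Ord_trans b (Ord_in M k b Ok Hb) (f (rank y))); [now apply H |].
  apply Hf; [exact Hy |]; apply powE; intros z Hz.
  apply VsE; [apply Ord_rank | now apply rank_mem].
Qed.

Lemma inaccessible_replacement x : rank x ∈ k -> bounded_maps x.
Proof.
  intros Hx F HF.
  destruct (bounded_maps_Vs (succ M (rank x)) (Lim_succ M k _ Lk Hx)
    (fun y => if excluded_middle_informative (y ∈ x) then F y else emp M)) as (b & Hb & H).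
  - intros y _; destruct excluded_middle_informative; [auto | now apply Lim_emp].
  - exists b; split; [exact Hb |]; intros y Hy.
    assert (HV : y ∈ Vs M (succ M (rank x))).
    { apply VsE; [apply Ord_succ, Ord_rank |]; apply succE; left; now apply rank_mem. }
    specialize (H y HV); cbn in H.
    destruct excluded_middle_informative; [exact H | contradiction].
Qed.

(** For the universe of trees this is the carrier of [R k]. *)
Definition level := {x : U | sat E (rank_lt x k)}.

Definition level_mem (x y : level) : Prop := proj1_sig x ∈ proj1_sig y.

Lemma level_rank (x : level) : rank (proj1_sig x) ∈ k.
Proof. destruct x as [x Hx]; exact (proj1 (sat_rank_lt M x k) Hx). Qed.

Lemma level_lift x : rank x ∈ k -> exists x' : level, proj1_sig x' = x.
Proof. intros Hx; now exists (exist _ x (proj2 (sat_rank_lt M x k) Hx)). Qed.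

Lemma level_inj (x y : level) : proj1_sig x = proj1_sig y -> x = y.
Proof.
  destruct x as [x Hx], y as [y Hy]; cbn; intros ->; f_equal; apply proof_irrelevance.
Qed.

Lemma level_elem x (y : level) : x ∈ proj1_sig y ->
  exists x' : level, proj1_sig x' = x /\ level_mem x' y.
Proof.
  intros H; destruct (level_lift x) as [x' Hx'].
  - exact (Ord_trans k Ok _ _ (level_rank y) (rank_mem M _ _ H)).
  - exists x'; split; [exact Hx' |]; unfold level_mem; now rewrite Hx'.
Qed.

(** A subclass of the level is a set of the level as soon as the ranks of its
    elements are bounded below [k]. *)
Lemma level_set_of (P : level -> Prop) c : c ∈ k ->
  (forall y, P y -> rank (proj1_sig y) ∈ c) -> exists b, forall y, level_mem y b <-> P y.
Proof.
  intros Hc HP.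
  assert (Hs : small (E := E) (fun y => exists y', y = proj1_sig y' /\ P y')).
  { apply (small_sub_rank M _ c (Ord_in M k c Ok Hc)); intros y (y' & -> & Hy); auto. }
  destruct Hs as [b Hb].
  destruct (level_lift b) as [b' Hb'].
  - apply (rank_bound M b c k Ok Hc); intros y Hy.
    apply Hb in Hy as (y' & -> & Hy); auto.
  - exists b'; intros y; unfold level_mem; rewrite Hb', Hb; split; [| eauto].
    intros (y' & H & Hy); now apply level_inj in H as ->.
Qed.

Lemma level_model : model level_mem.
Proof.
  split.
  - intros a b H; apply level_inj, (ext M); intros x; split; intros Hx;
      apply level_elem in Hx as (x' & <- & Hx'); now apply H.
  - exact (wf_inverse_image _ _ _ (fun x : level => proj1_sig x) (model_wf E M)).
  - intros a P HP.
    (* [F] sends [x] to the rank of its image under [P]. *)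
    assert (Hr : forall x, exists d, d ∈ k /\ forall x' y', proj1_sig x' = x ->
      level_mem x' a -> P x' y' -> rank (proj1_sig y') = d).
    { intros x; destruct (classic (exists x' y', proj1_sig x' = x /\
        level_mem x' a /\ P x' y')) as [(x' & y' & <- & Hx & Hy) | H].
      - exists (rank (proj1_sig y')); split; [apply level_rank |].
        intros x2 y2 H2 Hx2 Hy2; apply level_inj in H2 as ->.
        now rewrite (HP x' y' y2 Hx Hy Hy2).
      - exists (emp M); split; [now apply Lim_emp |].
        intros x' y' Hx' Hx Hy; destruct H; eauto 6. }
    apply choice in Hr as [F HF].
    destruct (inaccessible_replacement (proj1_sig a) (level_rank a) F) as (c & Hc & H);
      [intros; apply HF |].
    apply (level_set_of _ c Hc); intros y (x & Hx & Hy).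
    rewrite (proj2 (HF (proj1_sig x)) x y eq_refl Hx Hy); now apply H.
  - intros a; apply (level_set_of _ (rank (proj1_sig a)) (level_rank a)).
    intros y (z & Hz & Hy); eapply rank_trans; apply rank_mem; [exact Hy | exact Hz].
  - intros a.
    apply (level_set_of _ (succ M (rank (proj1_sig a))) (Lim_succ M k _ Lk (level_rank a))).
    intros y H; apply rank_sub; intros z Hz.
    apply level_elem in Hz as (z' & <- & Hz'); now apply H.
  - destruct (level_lift (omega M)) as [w Hw].
    { rewrite rank_Ord; [apply inaccessible_omega | apply Lim_Ord, Lim_omega]. }
    exists w; split.
    + destruct (level_elem (emp M) w) as (x & Hx & Hxw).
      { rewrite Hw; apply Lim_emp, Lim_omega. }
      exists x; split; [exact Hxw |]; intros z Hz; unfold level_mem in Hz.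
      rewrite Hx in Hz; now apply empE in Hz.
    + intros x Hx; destruct (level_elem (succ M (proj1_sig x)) w) as (y & Hy & Hyw).
      { rewrite Hw; apply Lim_succ; [apply Lim_omega |]; rewrite <- Hw; exact Hx. }
      exists y; split; [exact Hyw |]; intros u; unfold level_mem.
      rewrite Hy, succE; split; (intros [H | H]; [auto | right]);
        [now apply level_inj | now rewrite H].
Qed.

Lemma level_ordinal (x : level) : sat level_mem (ordinal x) <-> Ord (proj1_sig x).
Proof.
  split; intros [H1 H2]; split.
  - intros y Hy z Hz; apply level_elem in Hy as (y' & <- & Hy).
    apply level_elem in Hz as (z' & <- & Hz); exact (H1 y' Hy z' Hz).
  - intros y Hy z Hz; apply level_elem in Hy as (y' & <- & Hy).
    apply level_elem in Hz as (z' & <- & Hz).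
    destruct (H2 y' Hy z' Hz) as [H | [H | H]]; [left; exact H | | right; right; exact H].
    right; left; cbn in H |- *; congruence.
  - intros y Hy z Hz; exact (H1 _ Hy _ Hz).
  - intros y Hy z Hz; destruct (H2 _ Hy _ Hz) as [H | [H | H]];
      [left; exact H | | right; right; exact H].
    right; left; now apply level_inj.
Qed.

Lemma level_limit (x : level) : Lim (proj1_sig x) -> sat level_mem (limit x).
Proof.
  intros H; pose proof (Lim_emp M _ H) as He; apply level_elem in He as (e & _ & He).
  apply (Lim_intro x e); [apply level_ordinal; now apply Lim_Ord | exact He |].
  intros y Hy; destruct (Lim_next (proj1_sig x) (proj1_sig y) H Hy) as (z & Hz & Hyz).
  apply level_elem in Hz as (z' & <- & Hz); eauto.
Qed.

Lemma level_Ord_in (x : level) : Ord (proj1_sig x) -> proj1_sig x ∈ k.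
Proof. intros Hx; rewrite <- (rank_Ord M _ Hx); apply level_rank. Qed.

(** The ordinals of the level are the elements of [k], and subsets and sequences
    given by predicates on the level are sets of the ambient model. *)
Lemma level_subtle : sat E (subtle k) -> ord_subtle (E := level_mem).
Proof.
  intros [_ Hsub] S C C1 C2 C3.
  assert (HC : forall a, C a -> proj1_sig a ∈ k).
  { intros a Ha; apply level_Ord_in, level_ordinal, C1, Ha. }
  assert (Hc : small (E := E) (fun a => exists a', a = proj1_sig a' /\ C a')).
  { apply (small_sep M _ k); intros a (a' & -> & Ha); auto. }
  destruct Hc as [c Hc].
  assert (Hs : forall a, exists s, forall x, x ∈ s <-> x ∈ a /\ exists x' a',
    x = proj1_sig x' /\ a = proj1_sig a' /\ S a' x').
  { intros a; apply (small_sep M _ a); tauto. }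
  apply choice in Hs as [s Hs].
  destruct (Hsub (graph M s k) c) as (b & Hb & g & Hg & Hbg & sb & sg & Hsb & Hsg & Heq).
  - split; [apply fun_on_graph | split; [| split; [| split]]].
    + intros a Ha sa Hsa x Hx; apply (proj1 (sat_rel_graph M _ _ _ _)) in Hsa as [_ ->].
      now apply Hs in Hx.
    + intros a Ha; apply Hc in Ha as (a' & -> & Ha); now apply HC.
    + intros a Ha; assert (Oa : Ord a) by exact (Ord_in M k a Ok Ha).
      destruct (level_lift a) as [a' <-]; [now rewrite rank_Ord |].
      destruct (C2 a') as (b & Hb & Hab); [now apply level_ordinal |].
      exists (proj1_sig b); split; [apply Hc; eauto | exact Hab].
    + intros d Hd [Ld Hdc]; destruct (level_lift d) as [d' <-].
      { rewrite rank_Ord; [exact Hd | exact (Ord_in M k d Ok Hd)]. }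
      apply Hc; exists d'; split; [reflexivity |].
      apply C3; [now apply level_limit |].
      intros a Ha; destruct (Hdc _ Ha) as (b & Hb & Hbd & Hab).
      apply Hc in Hb as (b' & -> & Hb); eauto.
  - apply Hc in Hb as (b' & -> & Hb), Hg as (g' & -> & Hg).
    apply (proj1 (sat_rel_graph M _ _ _ _)) in Hsb as [_ ->], Hsg as [_ ->].
    exists b', g'; split; [exact Hb | split; [exact Hg | split; [exact Hbg |]]].
    assert (HS : forall x a, level_mem x a ->
      (S a x <-> proj1_sig x ∈ s (proj1_sig a))).
    { intros x a Hx; rewrite Hs; split; [intros H; split; eauto |].
      intros (_ & x' & a' & H1 & H2 & H); now apply level_inj in H1 as ->, H2 as ->. }
    intros x Hx.
    assert (Hxg : level_mem x g').
    { exact (Ord_trans _ (proj1 (level_ordinal g') (C1 g' Hg)) _ _ Hbg Hx). }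
    rewrite (HS x b' Hx), (HS x g' Hxg).
    apply (iff_trans (Heq (proj1_sig x))).
    change (proj1_sig x ∈ s (proj1_sig g') /\ proj1_sig x ∈ proj1_sig b' <->
      proj1_sig x ∈ s (proj1_sig g')); unfold level_mem in Hx; tauto.
Qed.

End Level.

(** * The universe of trees *)

Lemma eqt_refl x : eqt x x.
Proof. induction x as [A f IH]; split; intros i; exists i; apply IH. Qed.

Lemma eqt_sym x : forall y, eqt x y -> eqt y x.
Proof.
  induction x as [A f IH]; intros [B g] [H1 H2]; split.
  - intros j; destruct (H2 j) as [i Hi]; exists i; now apply IH.
  - intros i; destruct (H1 i) as [j Hj]; exists j; now apply IH.
Qed.

Lemma eqt_trans x : forall y z, eqt x y -> eqt y z -> eqt x z.
Proof.
  induction x as [A f IH]; intros [B g] [C h] [H1 H2] [H3 H4]; split.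
  - intros i; destruct (H1 i) as [j Hj], (H3 j) as [l Hl]; exists l; eauto.
  - intros l; destruct (H4 l) as [j Hj], (H2 j) as [i Hi]; exists i; eauto.
Qed.

Lemma class_eq x y : class x = class y <-> eqt x y.
Proof.
  split.
  - intros H; apply (f_equal (fun v => proj1_sig v y)) in H; cbn in H.
    rewrite H; apply eqt_refl.
  - intros H; unfold class.
    assert (He : eqt x = eqt y).
    { apply functional_extensionality; intros z; apply propositional_extensionality.
      split; intros Hz; eauto using eqt_trans, eqt_sym. }
    apply eq_sig_hprop; [intros; apply proof_irrelevance | exact He].
Qed.

Lemma class_onto (v : V) : exists x, v = class x.
Proof.
  destruct v as [c [x Hx]]; exists x.
  apply eq_sig_hprop; [intros; apply proof_irrelevance | exact Hx].
Qed.

Lemma mem_class a A f : mem a (class (node A f)) <-> exists i, a = class (f i).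
Proof.
  split.
  - intros (B & g & j & -> & H); apply class_eq in H as [_ H].
    destruct (H j) as [i Hi]; exists i; apply class_eq, eqt_sym, Hi.
  - intros [i ->]; exists A, f, i; auto.
Qed.

(** Stated for families indexed by a type: this gives replacement, union and power
    set, with index types that live in the universe of the trees. *)
Lemma V_family {I : Type} (g : I -> V) : exists b, forall y, mem y b <-> exists i, y = g i.
Proof.
  destruct (choice _ (fun i => class_onto (g i))) as [t Ht].
  exists (class (node I t)); intros y; rewrite mem_class.
  split; intros [i Hi]; exists i; congruence.
Qed.

Lemma V_model : model mem.
Proof.
  split.
  - intros a b H; destruct (class_onto a) as [[A f] ->], (class_onto b) as [[B g] ->].
    apply class_eq; split.
    + intros i; destruct (proj1 (mem_class (class (f i)) B g)) as [j Hj].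
      * apply H, mem_class; eauto.
      * exists j; now apply class_eq.
    + intros j; destruct (proj1 (mem_class (class (g j)) A f)) as [i Hi].
      * apply H, mem_class; eauto.
      * exists i; now apply class_eq.
  - intros a; destruct (class_onto a) as [x ->]; induction x as [A f IH].
    constructor; intros y Hy; apply mem_class in Hy as [i ->]; apply IH.
  - intros a P HP; destruct (class_onto a) as [[A f] ->].
    destruct (choice (fun (i : {i | exists y, P (class (f i)) y}) y =>
      P (class (f (proj1_sig i))) y)) as [g Hg]; [intros [i Hi]; exact Hi |].
    destruct (V_family g) as [b Hb]; exists b; intros y; rewrite Hb; split.
    + intros [i ->]; exists (class (f (proj1_sig i))); split; [apply mem_class; eauto | auto].
    + intros (x & Hx & Hy); pose proof Hx as Hx'; apply mem_class in Hx' as [i ->].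
      exists (exist _ i (ex_intro _ y Hy)).
      exact (HP _ _ _ Hx Hy (Hg (exist _ i (ex_intro _ y Hy)))).
  - intros a; destruct (class_onto a) as [[A f] ->].
    pose (dom t := match t with node B _ => B end).
    pose (sub t := match t return dom t -> tree with node _ h => h end).
    destruct (V_family (fun i : {i : A & dom (f i)} =>
      class (sub (f (projT1 i)) (projT2 i)))) as [b Hb].
    exists b; intros x; rewrite Hb; split.
    + intros [[i j] ->]; exists (class (f i)); split; [apply mem_class; eauto |]; cbn.
      destruct (f i) as [B h]; apply mem_class; exists j; reflexivity.
    + intros (y & Hy & Hx); apply mem_class in Hy as [i ->].
      assert (Hj : exists j : dom (f i), x = class (sub (f i) j)).
      { destruct (f i) as [B h]; now apply mem_class in Hx. }
      destruct Hj as [j ->]; now exists (existT _ i j).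
  - intros a; destruct (class_onto a) as [[A f] ->].
    destruct (V_family (fun p : A -> Prop =>
      class (node {i | p i} (fun i => f (proj1_sig i))))) as [b Hb].
    exists b; intros x; rewrite Hb; split.
    + intros [p ->] z Hz; apply mem_class in Hz as [[i Hi] ->]; apply mem_class; eauto.
    + intros H; exists (fun i => mem (class (f i)) x).
      destruct (class_onto x) as [[B g] ->]; apply class_eq; split.
      * intros j; destruct (proj1 (mem_class (class (g j)) A f)) as [i Hi].
        { apply H, mem_class; eauto. }
        assert (Hm : mem (class (f i)) (class (node B g))) by (apply mem_class; eauto).
        exists (exist _ i Hm); now apply class_eq.
      * intros [i Hi]; pose proof Hi as Hj; apply mem_class in Hj as [j Hj].
        exists j; cbn; apply class_eq; auto.
  - pose (tsucc t := match t with
      | node A f => node (option A) (fun o => match o with Some i => f i | None => t end)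
      end).
    pose (tnum := fix tnum n := match n with
      | O => node False (False_rect tree) | S n => tsucc (tnum n) end).
    destruct (V_family (fun n => class (tnum n))) as [w Hw]; exists w; split.
    + exists (class (tnum 0)); split; [apply Hw; eauto |].
      intros z Hz; now apply mem_class in Hz as [[] _].
    + intros x Hx; apply Hw in Hx as [n ->]; exists (class (tnum (S n))).
      split; [apply Hw; eauto |]; intros u; cbn.
      destruct (tnum n) as [A f] eqn:Hn; unfold tsucc; rewrite !mem_class; split.
      * intros [[i |] ->]; eauto.
      * intros [[i ->] | ->]; [now exists (Some i) | now exists None].
Qed.

Theorem theorem2p2 (theta : V) (htheta : sat mem (subtle theta)) :
  exists kappa : R theta,
    mem (proj1_sig kappa) theta /\ sat (@R_mem theta) (unfoldable kappa).
Proof.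
  assert (Hi : sat mem (inaccessible theta)) by (destruct htheta as [H _]; exact H).
  destruct (unfoldable_exists (level_model V_model theta Hi)
    (level_subtle V_model theta Hi htheta)) as (kappa & Ho & Hu).
  exists kappa; split; [| exact Hu].
  apply (level_Ord_in V_model theta kappa).
  exact (proj1 (level_ordinal V_model theta Hi kappa) Ho).
Qed.
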